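(* Let $\Phi$ be the root system of a crystallographic based root datum. Let $\mathcal{R}$ denote the set of all pairs $(\Psi,Y)$ where $\Psi$ is a root subsystem of $\Phi$ and $Y\in\Omega(\Psi)/X$ is a coset of some admissible subgroup $X$ of the coweight lattice $\Omega(\Psi)$. Then there is a bijection from $\mathcal{R}$ to the set of all root functions $\mathcal{Z}:\Phi\to\mathcal{P}(\mathbb{Z})$, which attaches to $(\Psi,Y)\in\mathcal{R}$ the unique root function $\mathcal{Z}$ with support $\Psi$ such that $\mathcal{Z}(\alpha)=Y(\alpha_0)$ for all $\alpha\in\Psi$.
   Context: Conventions: $\mathbb{N}=\{0,1,2,\dots\}$; $\mathcal{P}(\mathbb{Z})$ is the power set of $\mathbb{Z}$; $a\mid b$ means $b\in a\mathbb{Z}$. For subsets $A,B$ of an abelian group and $n\in\mathbb{Z}$: $A\pm B=\{a\pm b\mid a\in A,b\in B\}$, $nA=\{na\mid a\in A\}$. Based root data. A subset $\Gamma$ of a real vector space is positively independent if $\sum_{\alpha\in\Gamma}c_\alpha\alpha=0$ with all $c_\alpha\ge 0$, almost all zero, implies all $c_\alpha=0$. A generalised Cartan matrix is a possibly infinite matrix $(c_{\alpha,\beta})_{\alpha,\beta\in\Pi}$ with $c_{\alpha,\alpha}=2$ and, for $\alpha\ne\beta$, $c_{\alpha,\beta}\in\mathbb{Z}_{\le 0}$ with $c_{\alpha,\beta}=0$ iff $c_{\beta,\alpha}=0$. A crystallographic based root datum is a tuple $B=(V,V^\vee,\Pi,\Pi^\vee,\langle-,-\rangle,\iota)$ where $V,V^\vee$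 are real vector spaces, $\langle-,-\rangle:V\times V^\vee\to\mathbb{R}$ is bilinear, $\Pi\subseteq V$ and $\Pi^\vee\subseteq V^\vee$ are positively independent, and $\iota:\Pi\to\Pi^\vee$, $\alpha\mapsto\alpha^\vee$, is a bijection such that $(\langle\alpha,\beta^\vee\rangle)_{\alpha,\beta\in\Pi}$ is a generalised Cartan matrix. For $\alpha\in\Pi$ let $s_\alpha(v)=v-\langle v,\alpha^\vee\rangle\alpha$ on $V$; let $W=\langle s_\alpha\mid\alpha\in\Pi\rangle$, $\Phi=W\Pi$ (the root system), $\Phi_+=\Phi\cap\mathbb{R}_{\ge0}\Pi$. Dually, the reflections $u\mapsto u-\langle\alpha,u\rangle\alpha^\vee$ ($\alpha\in\Pi$) of $V^\vee$ generate a group canonically isomorphic to $W$, with $\Phi^\vee=W\Pi^\vee$; $\iota$ extends uniquely to a $W$-equivariant bijection $\Phi\to\Phi^\vee$, $\alpha\mapsto\alpha^\vee$. For $\alpha\in\Phi$, $s_\alpha(v)=v-\langle v,\alpha^\vee\rangle\alpha$. Root subsystems. A root subsystem of $\Phi$ is a subset $\Psi\subseteq\Phi$ such that $\alpha,\beta\in\Psi$ implies $s_\alpha(\beta)\in\Psi$. For $\Gamma\subseteq\Phi$, $W_\Gamma=\langle s_\alpha\mid\alpha\in\Gamma\rangle$. Every root subsystem $\Psi$ has a canonical simple system $\Gamma\subseteq\Psi$, the unique $\Gamma\subseteq\Phi_+$ with $W_\Gamma=W_\Psi$ and $\langle\alpha,\beta^\vee\rangle\le0$ for distinct $\alpha,\beta\in\Gamma$.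 Lifting. Let $\Psi$ be a root subsystem with canonical simple system $\Gamma$. Let $V_0$, $V_0^\vee$ be real vector spaces with bases $\Gamma_0=\{\alpha_0\mid\alpha\in\Gamma\}$, $\Gamma_0^\vee=\{\alpha_0^\vee\mid\alpha\in\Gamma\}$ in bijection with $\Gamma$, and let $\langle-,-\rangle_0:V_0\times V_0^\vee\to\mathbb{R}$ be the bilinear form with $\langle\alpha_0,\beta_0^\vee\rangle_0=\langle\alpha,\beta^\vee\rangle$ for $\alpha,\beta\in\Gamma$. This gives a based root datum with simple roots $\Gamma_0$; let $\Psi_0\subseteq V_0$ be its root system. The linear map $L:V_0\to V$ with $L(\alpha_0)=\alpha$ for $\alpha\in\Gamma$ restricts to a bijection $\Psi_0\to\Psi$, whose inverse is denoted $\alpha\mapsto\alpha_0$. The coweight lattice of $\Psi$ is $\Omega(\Psi)=\mathrm{Hom}_{\mathbb{Z}}(\mathbb{Z}\Psi_0,\mathbb{Z})$, where $\mathbb{Z}\Psi_0$ is the additive subgroup generated by $\Psi_0$ (free abelian on $\Gamma_0$). For $X\subseteq\Omega(\Psi)$ and $\beta\in\mathbb{Z}\Psi_0$, $X(\beta)=\{f(\beta)\mid f\in X\}\subseteq\mathbb{Z}$. Admissible subgroups. A subgroup $X\subseteq\Omega(\Psi)$ is admissible if there is a function $N:\Psi\to\mathbb{N}$, $\alpha\mapsto n_\alpha$, with $n_\beta\mathbb{Z}-\langle\beta,\alpha^\vee\rangle n_\alpha\mathbb{Z}\subseteq n_{s_\alpha(\beta)}\mathbb{Z}$ for all $\alpha,\beta\in\Psi$,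 such that $X=\{f\in\Omega(\Psi)\mid f(\alpha_0)\in n_\alpha\mathbb{Z}\text{ for all }\alpha\in\Psi\}$. Root functions. A root function is a function $\mathcal{Z}:\Phi\to\mathcal{P}(\mathbb{Z})$, $\alpha\mapsto Z_\alpha$, such that $Z_\beta-\langle\beta,\alpha^\vee\rangle Z_\alpha\subseteq Z_{s_\alpha(\beta)}$ for all $\alpha,\beta\in\Phi$. Its support is $\{\alpha\in\Phi\mid Z_\alpha\ne\emptyset\}$. *)

(* Defs.v *)
From HB Require Import structures.
From mathcomp Require Import all_boot all_order all_algebra.
From mathcomp Require Import all_classical reals.
From mathcomp.multinomials Require Import freeg.

Set Implicit Arguments.
Unset Strict Implicit.
Unset Printing Implicit Defensive.

Import Order.TTheory GRing.Theory Num.Theory.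

Local Open Scope classical_set_scope.
Local Open Scope ring_scope.

Definition is_subgroup (U : zmodType) (M : set U) : Prop :=
  M 0 /\ forall x y, M x -> M y -> M (x - y).

Definition zspan (U : zmodType) (A : set U) : set U :=
  smallest (@is_subgroup U) A.

Lemma zspan_subgroup (U : zmodType) (A : set U) : is_subgroup (zspan A).
Proof.
split.
  by move=> M [[M0 _] _].
move=> x y Ax Ay M MA; have [[_ MB] _] := MA.
by apply: MB; [exact: (Ax M MA)|exact: (Ay M MA)].
Qed.

Section ZSpanZmodule.
Variables (U : zmodType) (A : set U).

Definition zspan_pred : {pred U} := fun x => x \in zspan A.

Fact zspan_zmod_closed : zmod_closed zspan_pred.
Proof.
have [z0 zB] := zspan_subgroup A.
split=> [|x y /set_mem Ax /set_mem Ay]; first exact: mem_set z0.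
exact: mem_set (zB x y Ax Ay).
Qed.

HB.instance Definition _ :=
  GRing.isZmodClosed.Build U zspan_pred zspan_zmod_closed.

(* The subgroup generated by [A], as a type. *)
Record zspan_of : Type :=
  ZSpan { zspan_val :> U; zspan_valP : zspan_val \in zspan_pred }.

HB.instance Definition _ := [isSub of zspan_of for zspan_val].
HB.instance Definition _ := [Choice of zspan_of by <:].
HB.instance Definition _ := [SubChoice_isSubZmodule of zspan_of by <:].

End ZSpanZmodule.

(* Groups of bijections of [T]; every member of the group generated by a set of
   bijections is a bijection. *)
Definition is_transf_group (T : Type) (G : set (T -> T)) : Prop :=
  [/\ G id, (forall f g, G f -> G g -> G (f \o g)) &
      (forall f g, G f -> cancel f g -> cancel g f -> G g)].

Definition gen_group (T : Type) (S : set (T -> T)) : set (T -> T) :=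
  smallest (@is_transf_group T) S.

Definition pos_indep (R : realType) (V : lmodType R) (G : set V) : Prop :=
  forall c : V -> R,
    (forall a, G a -> 0 <= c a) ->
    finite_set [set a | G a /\ c a != 0] ->
    \sum_(a \in G) c a *: a = 0 ->
    forall a, G a -> c a = 0.

Definition pos_cone (R : realType) (V : lmodType R) (G : set V) : set V :=
  [set v | exists c : V -> R,
    [/\ (forall a, G a -> 0 <= c a),
        finite_set [set a | G a /\ c a != 0] &
        v = \sum_(a \in G) c a *: a]].

(* The data of a tuple (V, V^vee, Pi, Pi^vee, <-,->, iota) are separated from
   the axioms, so that the root system of the lifted datum can be named before
   the lifted datum is known to satisfy them.  Only the values of
   [simple_iota] on [simple_roots] are meaningful. *)
Record rootdata (R : realType) (V V' : lmodType R) := RootData {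
  simple_roots : set V;
  simple_coroots : set V';
  root_pairing : V -> V' -> R;
  simple_iota : V -> V' }.

Record crystallographic (R : realType) (V V' : lmodType R)
    (B : rootdata V V') : Prop := Crystallographic {
  cr_bilinear : (forall u, scalar (root_pairing B ^~ u)) /\
                (forall v, scalar (root_pairing B v));
  cr_simple : pos_indep (simple_roots B);
  cr_cosimple : pos_indep (simple_coroots B);
  cr_iota : set_bij (simple_roots B) (simple_coroots B) (simple_iota B);
  cr_diag : forall a, simple_roots B a -> root_pairing B a (simple_iota B a) = 2;
  cr_offdiag : forall a b, simple_roots B a -> simple_roots B b -> a <> b ->
    [/\ root_pairing B a (simple_iota B b) \is a Num.int,
        root_pairing B a (simple_iota B b) <= 0 &
        root_pairing B a (simple_iota B b) = 0 <->
        root_pairing B b (simple_iota B a) = 0] }.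

Section RootSystem.
Variables (R : realType) (V V' : lmodType R) (B : rootdata V V').

Definition reflection (a : V) (a' : V') (v : V) : V :=
  v - root_pairing B v a' *: a.
Definition coreflection (a : V) (a' u : V') : V' :=
  u - root_pairing B a u *: a'.

Definition weyl : set (V -> V) :=
  gen_group [set reflection a (simple_iota B a) | a in simple_roots B].
Definition coweyl : set (V' -> V') :=
  gen_group [set coreflection a (simple_iota B a) | a in simple_roots B].

Definition root_system : set V := [set w a | w in weyl & a in simple_roots B].
Definition coroot_system : set V' :=
  [set w u | w in coweyl & u in simple_coroots B].

Definition positive_roots : set V := root_system `&` pos_cone (simple_roots B).

(* [f] extends iota to a W-equivariant bijection Phi -> Phi^vee.  W acts on
   V^vee by letting the simple reflection of [a] act as the simple coreflection
   of [a], so equivariance need only be asked for these generators. *)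
Definition is_coroot_map (f : V -> V') : Prop :=
  [/\ (forall a, simple_roots B a -> f a = simple_iota B a),
      set_bij root_system coroot_system f &
      forall a b, simple_roots B a -> root_system b ->
        f (reflection a (simple_iota B a) b) =
        coreflection a (simple_iota B a) (f b)].

(* The extension is unique on Phi; values outside Phi are irrelevant. *)
Definition coroot : V -> V' := xget (fun=> 0) [set f | is_coroot_map f].

Definition root_refl (a : V) : V -> V := reflection a (coroot a).

Definition cartan (b a : V) : R := root_pairing B b (coroot a).

Definition root_subsystem (Psi : set V) : Prop :=
  Psi `<=` root_system /\ forall a b, Psi a -> Psi b -> Psi (root_refl a b).

Definition refl_group (G : set V) : set (V -> V) :=
  gen_group [set root_refl a | a in G].

Definition is_canonical_simple (Psi G : set V) : Prop :=
  [/\ G `<=` Psi, G `<=` positive_roots, refl_group G = refl_group Psi &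
      forall a b, G a -> G b -> a <> b -> cartan a b <= 0].

(* The unique set with this property when [Psi] is a root subsystem. *)
Definition canonical_simple (Psi : set V) : set V :=
  xget set0 [set G | is_canonical_simple Psi G].

(* Z_b - <b, a^vee> Z_a is contained in Z_(s_a b) for all a, b in D.  The
   inclusion is one between subsets of the reals, so that the Cartan integer
   does not have to be converted from a real number; the sets D used below are
   stable under the reflections s_a, a in D, so that c exists. *)
Definition refl_compatible (D : set V) (Z : D -> set int) : Prop :=
  forall a b c : D, val c = root_refl (val a) (val b) ->
    [set (x%:~R - cartan (val b) (val a) * y%:~R : R) | x in Z b & y in Z a]
    `<=` [set z%:~R | z in Z c].

Definition root_function (Z : root_system -> set int) : Prop := refl_compatible Z.

Definition root_support (Z : root_system -> set int) : set V :=
  [set val a | a in [set a | Z a !=set0]].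

(* V_0 and V_0^vee are both the free vector space on the set Gamma; the basis
   vector << a >> stands for a_0 in the former and for a_0^vee in the latter,
   whence iota_0 is the identity. *)
Definition lift_space (Psi : set V) : lmodType R :=
  {freeg (canonical_simple Psi : choiceType) / R}.

Definition lift_basis (Psi : set V) : set (lift_space Psi) :=
  [set << a >> | a in [set: canonical_simple Psi]].

Definition lift_pairing (Psi : set V) (v u : lift_space Psi) : R :=
  fglift (fun a => fglift (fun b => cartan (val a) (val b) : R^o) u : R^o) v.

Definition lift_data (Psi : set V) :
    rootdata (lift_space Psi) (lift_space Psi) :=
  RootData (@lift_basis Psi) (@lift_basis Psi) (@lift_pairing Psi) id.

Definition lift_map (Psi : set V) : lift_space Psi -> V :=
  fglift (val : canonical_simple Psi -> V).

End RootSystem.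

Section Coweights.
Variables (R : realType) (V V' : lmodType R) (B : rootdata V V').

Definition lift_root_system (Psi : set V) : set (lift_space B Psi) :=
  root_system (lift_data B Psi).

Definition root_lattice (Psi : set V) : zmodType :=
  zspan_of (@lift_root_system Psi).

Definition coweights (Psi : set V) : set (root_lattice Psi -> int) :=
  [set f | zmod_morphism f].

(* a |-> a_0, the inverse of the bijection Psi_0 -> Psi induced by L. *)
Definition lift_root (Psi : set V) (a : Psi) : root_lattice Psi :=
  xget 0 [set x | @lift_root_system Psi (val x) /\ lift_map (val x) = val a].

Definition values (Psi : set V) (X : set (root_lattice Psi -> int))
    (b : root_lattice Psi) : set int := [set f b | f in X].

Definition multiples (n : nat) : set int := [set x | (n%:Z %| x)%Z].

Definition admissible (Psi : set V) (X : set (root_lattice Psi -> int)) : Prop :=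
  [/\ X `<=` @coweights Psi, is_subgroup X &
      exists n : Psi -> nat,
        refl_compatible B (fun a => multiples (n a)) /\
        X = [set f | @coweights Psi f /\
                     forall a, multiples (n a) (f (lift_root a))]].

Definition is_coset (Psi : set V) (X Y : set (root_lattice Psi -> int)) : Prop :=
  exists2 f, @coweights Psi f & Y = [set f + g | g in X].

Definition subsystem_cosets :
    set {Psi : set V & set (root_lattice Psi -> int)} :=
  [set p | root_subsystem B (projT1 p) /\
           exists X, admissible X /\ is_coset X (projT2 p)].

(* The root [a] of Phi, when it lies in Psi, appears as an element [b] of Psi. *)
Definition attached (p : {Psi : set V & set (root_lattice Psi -> int)})
    (Z : root_system B -> set int) : Prop :=
  [/\ root_function Z, root_support Z = projT1 p &
      forall (a : root_system B) (b : projT1 p), val a = val b ->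
        Z a = values (projT2 p) (lift_root b)].

End Coweights.

(* Main.v *)
(* Let [f] be a coweight of [Psi] with [f (g_0)] in [Z_g] for every canonical
   simple root [g]; it exists because the [g_0] form a basis of the root lattice.
   Applying the simple reflections of [Psi] gives [f (a_0)] in [Z_a] for all [a],
   so [a |-> Z_a - f (a_0)] is a root function containing 0 everywhere.  Such a
   function takes values [n_a Z], because a subset of [Z] that contains 0 and is
   stable under [x, y |-> x - 2 y] is a subgroup.  Hence [Z] is the function
   attached to the coset of [f], and the coset is recovered from [Z] as the set
   of coweights [h] with [h (a_0)] in [Z_a].

   The Coxeter theory behind this is Deodhar's: a word of simple reflections that
   keeps all simple roots positive is trivial in the Coxeter group of the Cartan
   matrix, hence acts trivially in every realization of the matrix or of its
   transpose.  Identities between roots therefore pass to coroots and to the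
   lifted root system. *)

Require Import Defs.
From HB Require Import structures.
From mathcomp Require Import all_boot all_order all_algebra.
From mathcomp Require Import all_classical reals.
From mathcomp.multinomials Require Import freeg.
From mathcomp Require Import ring lra zify.

Set Implicit Arguments.
Unset Strict Implicit.
Unset Printing Implicit Defensive.

Import Order.TTheory GRing.Theory Num.Theory.

Local Open Scope classical_set_scope.
Local Open Scope ring_scope.

(** * Realizations of a generalised Cartan matrix *)

(** The obstacle is that simple roots are only positively independent. Vectors of [V] then have no
    well-defined coordinates along them, so an equality w(a_i) = w'(a_j) gives, by linear algebra
    alone, no information about coroots or about [V_0]. What remains of independence is salience:
    only 0 has both itself and its opposite in the cone of simple roots. It suffices to turn an
    equality of roots into a relation between words, and such relations depend on the products c_ij
    c_ji alone. The argument is needed twice: for the simple roots of the datum, to construct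
    coroots, and for the canonical simple roots of a subsystem, which may again be dependent, to
    construct a_0. Their existence comes from the positive roots g of Psi whose reflection keeps all
    other positive roots of Psi positive. That cosets and root functions determine each other also
    requires that an admissible subgroup attain every element of n_a Z at a_0. *)

Record gcm (R : realType) (I : eqType) (c : I -> I -> R) : Prop := Gcm {
  gcm_diag : forall i, c i i = 2;
  gcm_int : forall i j, c i j \is a Num.int;
  gcm_le0 : forall i j, i != j -> c i j <= 0;
  gcm_eq0 : forall i j, c i j = 0 -> c j i = 0 }.

Lemma gcm_tr (R : realType) (I : eqType) (c : I -> I -> R) :
  gcm c -> gcm (fun i j => c j i).
Proof.
case=> c1 c2 c3 c4; split=> //; first by move=> i j neq_ij; apply: c3; rewrite eq_sym.
by move=> i j; apply: c4.
Qed.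

Lemma gcm_nat (R : realType) (I : eqType) (c : I -> I -> R) i j :
  gcm c -> i != j -> exists n : nat, c i j = - n%:R.
Proof.
move=> gc neq_ij; have : - c i j \is a Num.nat.
  by rewrite natrEint rpredN gcm_int //= oppr_ge0 gcm_le0.
by move=> /natrP[n e]; exists n; rewrite -e opprK.
Qed.

(** No independence is asked of the vectors or the forms. One notion thus covers the simple roots in
    [V], the simple coroots with the transposed matrix, the canonical simple roots of a subsystem,
    and the basis of [V_0]. *)
Record realization (R : realType) (I : Type) (c : I -> I -> R)
    (V : lmodType R) := Realization {
  rvec : I -> V;
  rform : I -> V -> R;
  rform_scalar : forall i, scalar (rform i);
  rform_vec : forall i j, rform j (rvec i) = c i j }.

Section Action.
Variables (R : realType) (I : eqType) (c : I -> I -> R) (V : lmodType R).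
Variable D : realization c V.

Local Notation a := (rvec D).
Local Notation phi := (rform D).

Lemma rformZ i x v : phi i (x *: v) = x * phi i v.
Proof.
have h := rform_scalar D i; have e0 : phi i 0 = 0.
  by have /eqP := h 1 0 0; rewrite scaler0 addr0 mul1r -subr_eq subrr => /eqP <-.
by have := h x v 0; rewrite addr0 e0 addr0.
Qed.

Lemma rformD i v w : phi i (v + w) = phi i v + phi i w.
Proof. by have := rform_scalar D i 1 v w; rewrite scale1r mul1r. Qed.

Lemma rform0 i : phi i 0 = 0.
Proof. by rewrite -[0 in LHS](scale0r 0) rformZ mul0r. Qed.

Lemma rformN i v : phi i (- v) = - phi i v.
Proof. by rewrite -scaleN1r rformZ mulN1r. Qed.

Lemma rformB i v w : phi i (v - w) = phi i v - phi i w.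
Proof. by rewrite rformD rformN. Qed.

Definition rformE := (rformD, rformB, rformN, rformZ, rform0, rform_vec).

Definition srefl i v := v - phi i v *: a i.
Definition act w v := foldr srefl v w.

Lemma act_cat w1 w2 v : act (w1 ++ w2) v = act w1 (act w2 v).
Proof. exact: foldr_cat. Qed.

Lemma act_rcons w i v : act (rcons w i) v = act w (srefl i v).
Proof. by rewrite -cats1 act_cat. Qed.

Lemma srefl_scale i x v : srefl i (x *: v) = x *: srefl i v.
Proof. by rewrite /srefl rformE scalerBr scalerA. Qed.

Lemma sreflD i v w : srefl i (v + w) = srefl i v + srefl i w.
Proof. by rewrite /srefl rformE scalerDl opprD addrACA. Qed.

Lemma actZ w x v : act w (x *: v) = x *: act w v.
Proof. by elim: w => //= i w ->; rewrite srefl_scale. Qed.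

Lemma actD w u v : act w (u + v) = act w u + act w v.
Proof. by elim: w => //= i w ->; rewrite sreflD. Qed.

Lemma actN w v : act w (- v) = - act w v.
Proof. by rewrite -scaleN1r actZ scaleN1r. Qed.

Lemma actB w u v : act w (u - v) = act w u - act w v.
Proof. by rewrite actD actN. Qed.

Lemma act0 w : act w 0 = 0.
Proof. by rewrite -[0 in LHS](scale0r 0) actZ scale0r. Qed.

Definition actE := (actD, actB, actN, actZ, act0).

Hypothesis c_gcm : gcm c.

Lemma srefl_vec i : srefl i (a i) = - a i.
Proof.
by rewrite /srefl rformE (gcm_diag c_gcm) scaler_nat mulr2n opprD addrA subrr add0r.
Qed.

Lemma sreflK i v : srefl i (srefl i v) = v.
Proof.
by rewrite {2}/srefl sreflD -scaleN1r !srefl_scale srefl_vec scaleN1r scalerN opprK subrK.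
Qed.

Lemma act_revK w v : act (rev w) (act w v) = v.
Proof.
elim: w v => //= i w IH v; rewrite rev_cons act_rcons sreflK; exact: IH.
Qed.

Lemma act_Krev w v : act w (act (rev w) v) = v.
Proof. by have := act_revK (rev w) v; rewrite revK. Qed.

Lemma act_inj w : injective (act w).
Proof. exact: (can_inj (act_revK w)). Qed.

Lemma rform_act_int w i j : phi j (act w (a i)) \is a Num.int.
Proof.
elim: w j => [|k w IH] j /=; first by rewrite rformE gcm_int.
by rewrite rformB rformZ rform_vec rpredB // rpredM // gcm_int.
Qed.

Lemma act_refl w i v :
  act (w ++ i :: rev w) v = v - phi i (act (rev w) v) *: act w (a i).
Proof. by rewrite act_cat /= {1}/srefl !actE act_Krev. Qed.

End Action.

Arguments srefl_scale {R I c V}.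

(* [ralt j i k] is the alternating word of length [k] in [i] and [j] that ends
   in [j]. *)
Fixpoint ralt (I : Type) (j i : I) (k : nat) : seq I :=
  if k is k'.+1 then (if odd k' then i else j) :: ralt j i k' else [::].

Lemma size_ralt (I : Type) (j i : I) k : size (ralt j i k) = k.
Proof. by elim: k => //= k ->. Qed.

Lemma ralt_rcons (I : Type) (j i : I) k : ralt j i k.+1 = rcons (ralt i j k) j.
Proof. by elim: k => //= k <-; case: (odd k). Qed.

Lemma ralt_cat (I : Type) (j i : I) k m :
  exists2 u, size u = k & ralt j i (k + m) = u ++ ralt j i m.
Proof.
elim: k => [|k [u su e]]; first by exists [::].
by exists ((if odd (k + m) then i else j) :: u); rewrite /= ?su ?e.
Qed.

(* [bond (c_ij c_ji) m]: the product of the reflections s_i and s_j has finite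
   order [m]. *)
Definition bond (R : realType) (x : R) (m : nat) : Prop :=
  [\/ x = 0 /\ m = 2%N, x = 1 /\ m = 3%N, x = 2 /\ m = 4%N | x = 3 /\ m = 6%N].

(** Equality in the Coxeter group of [c], as a congruence on words; the length of an element is the
    least size in its class. A product c_ij c_ji of at least 4 gives no braid relation. *)
Inductive ceq (R : realType) (I : eqType) (c : I -> I -> R) :
    seq I -> seq I -> Prop :=
| ceq_refl w : ceq c w w
| ceq_sym w w' : ceq c w w' -> ceq c w' w
| ceq_trans w w' w'' : ceq c w w' -> ceq c w' w'' -> ceq c w w''
| ceq_ctx u v w w' : ceq c w w' -> ceq c (u ++ w ++ v) (u ++ w' ++ v)
| ceq_inv i : ceq c [:: i; i] [::]
| ceq_braid i j m : i != j -> bond (c i j * c j i) m ->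
    ceq c (ralt j i m) (ralt i j m).

(** * Braid relations in a realization *)

Section Braid.
Variables (R : realType) (I : eqType) (c : I -> I -> R) (V : lmodType R).
Variable D : realization c V.
Hypothesis c_gcm : gcm c.

(** The coefficients x and y are formal, since a_i and a_j may be dependent. The summand v lets the
    same rule evaluate alternating words on all of [V]. *)
Lemma srefl_plane1 i j v x y : 
  srefl D i (v + x *: rvec D i + y *: rvec D j) =
  v + (- x - y * c j i - rform D i v) *: rvec D i + y *: rvec D j.
Proof.
rewrite /srefl !(rformE, gcm_diag c_gcm).
rewrite addrAC; congr (_ + _); rewrite -addrA; congr (_ + _).
rewrite -scalerBl; congr (_ *: _); ring.
Qed.

Lemma srefl_plane2 i j v x y :
  srefl D j (v + x *: rvec D i + y *: rvec D j) =
  v + x *: rvec D i + (- y - x * c i j - rform D j v) *: rvec D j.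
Proof. by rewrite addrAC srefl_plane1 addrAC. Qed.

Lemma nat_bond (p q m : nat) : bond (- p%:R * - q%:R : R) m ->
  [\/ (p * q = 0)%N /\ m = 2%N, (p * q = 1)%N /\ m = 3%N,
      (p * q = 2)%N /\ m = 4%N | (p * q = 3)%N /\ m = 6%N].
Proof.
rewrite mulrNN -natrM; move=> [] [/eqP e ->].
- by constructor 1; move: e; rewrite pnatr_eq0 => /eqP ->.
- by constructor 2; move: e; rewrite pnatr_eq1 => /eqP ->.
- by constructor 3; move: e; rewrite eqr_nat => /eqP ->.
- by constructor 4; move: e; rewrite eqr_nat => /eqP ->.
Qed.

(** With c_ij = -p and c_ji = -q, a product p q of at most 3 leaves six pairs (p, q). For each of
    them both words are evaluated on v + 0 a_i + 0 a_j. *)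
Lemma act_braid i j m v : i != j -> bond (c i j * c j i) m ->
  act D (ralt j i m) v = act D (ralt i j m) v.
Proof.
move=> neq_ij bm.
have [p ep] := gcm_nat c_gcm neq_ij.
have [q eq] : exists q : nat, c j i = - q%:R by apply: gcm_nat => //; rewrite eq_sym.
have h0 : c i j = 0 <-> c j i = 0 by split; apply: gcm_eq0.
move: bm; rewrite ep eq in h0 * => /nat_bond bm.
have ev : v = v + 0 *: rvec D i + 0 *: rvec D j by rewrite !scale0r !addr0.
have cases : [\/ [/\ p = 0%N, q = 0%N & m = 2%N],
   [/\ p = 1%N, q = 1%N & m = 3%N],
   ([/\ p = 1%N, q = 2%N & m = 4%N] \/ [/\ p = 2%N, q = 1%N & m = 4%N]) |
   ([/\ p = 1%N, q = 3%N & m = 6%N] \/ [/\ p = 3%N, q = 1%N & m = 6%N])].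
  case: bm => [] [pq ->].
  - constructor 1.
    (* Zeros of the matrix are symmetric, so p q = 0 forces p = q = 0. *)
    move/eqP: pq; rewrite muln_eq0 => /orP[] /eqP e; subst.
      have := h0.1 (oppr0 _) => /eqP; rewrite oppr_eq0 pnatr_eq0 => /eqP ->.
      by split.
    have := h0.2 (oppr0 _) => /eqP; rewrite oppr_eq0 pnatr_eq0 => /eqP ->.
    by split.
  - by constructor 2; move/eqP: pq; rewrite muln_eq1 => /andP[/eqP-> /eqP->].
  - have p_le2 : (p <= 2)%N by apply: dvdn_leq => //; rewrite -pq dvdn_mulr.
    constructor 3; have [e|[e|e]] : p = 0%N \/ p = 1%N \/ p = 2%N by lia.
    + by rewrite e mul0n in pq.
    + by left; split; rewrite // -pq e mul1n.
    + by right; split=> //; move: pq; rewrite e; lia.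
  - have p_le3 : (p <= 3)%N by apply: dvdn_leq => //; rewrite -pq dvdn_mulr.
    constructor 4; have [e|[e|[e|e]]] :
      p = 0%N \/ p = 1%N \/ p = 2%N \/ p = 3%N by lia.
    + by rewrite e mul0n in pq.
    + by left; split; rewrite // -pq e mul1n.
    + by move: pq; rewrite e; lia.
    + by right; split=> //; move: pq; rewrite e; lia.
have {}ep : c i j = - p%:R by [].
have {}eq : c j i = - q%:R by [].
rewrite ev.
case: cases => [[pe qe ->]|[pe qe ->]|[|] [pe qe ->]|[|] [pe qe ->]];
  rewrite /= !(srefl_plane1, srefl_plane2) ep eq pe qe;
  (congr (_ + _ *: _ + _ *: _); ring).
Qed.

Lemma act_ceq w w' v : ceq c w w' -> act D w v = act D w' v.
Proof.
move=> h; elim: h v => //=.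
- by move=> {}w {}w' w'' _ IH1 _ IH2 v; rewrite IH1 IH2.
- by move=> u x {}w {}w' _ IH v; rewrite !act_cat IH.
- by move=> i v; rewrite sreflK.
- by move=> i j m neq_ij b v; exact: act_braid.
Qed.

End Braid.

(** * Positivity of roots *)

Inductive cone (R : realType) (V : lmodType R) (I : Type) (a : I -> V) : V -> Prop :=
| cone0 : cone a 0
| coneA x i v : 0 <= x -> cone a v -> cone a (x *: a i + v).

Section Cone.
Variables (R : realType) (V : lmodType R) (I : Type) (a : I -> V).

Lemma cone_gen i : cone a (a i).
Proof. by rewrite -[a i]addr0 -[a i]scale1r; apply: coneA; [exact: ler01|exact: cone0]. Qed.

Lemma coneD u v : cone a u -> cone a v -> cone a (u + v).
Proof.
move=> cu cv; elim: cu => [|x i w x0 _ IH]; first by rewrite add0r.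
by rewrite -addrA; apply: coneA.
Qed.

Lemma coneZ x v : 0 <= x -> cone a v -> cone a (x *: v).
Proof.
move=> x0; elim=> [|y i w y0 _ IH]; first by rewrite scaler0; apply: cone0.
by rewrite scalerDr scalerA; apply: coneA => //; apply: mulr_ge0.
Qed.

End Cone.

Section Positivity.
Variables (R : realType) (I : eqType) (c : I -> I -> R) (V : lmodType R).
Variable D : realization c V.
Hypothesis c_gcm : gcm c.

Local Notation a := (rvec D).

(** The rank two case, on which the positivity of roots rests. The cases p q >= 4 and p q <= 3 are
    those of infinite and of finite order of s_i s_j. *)
Lemma ralt_cone i j k : i != j ->
  (forall m, bond (c i j * c j i) m -> (k < m)%N) ->
  exists A B : R, [/\ 0 <= A, 0 <= B &
    act D (ralt j i k) (a i) = A *: a i + B *: a j].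
Proof.
move=> neq_ij km.
have [p ep] := gcm_nat c_gcm neq_ij.
have [q eq] : exists q : nat, c j i = - q%:R by apply: gcm_nat => //; rewrite eq_sym.
have stepi x y : srefl D i (x *: a i + y *: a j) = (q%:R * y - x) *: a i + y *: a j.
  have := srefl_plane1 D c_gcm i j 0 x y; rewrite !add0r rform0 eq => ->.
  by congr (_ *: _ + _ *: _); ring.
have stepj x y : srefl D j (x *: a i + y *: a j) = x *: a i + (p%:R * x - y) *: a j.
  have := srefl_plane2 D c_gcm i j 0 x y; rewrite !add0r rform0 ep => ->.
  by congr (_ *: _ + _ *: _); ring.
have ei : a i = 1 *: a i + 0 *: a j by rewrite scale1r scale0r addr0.
have p0 : 0 <= p%:R :> R := ler0n _ _.
have q0 : 0 <= q%:R :> R := ler0n _ _.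
have [lt4|ge4] := ltnP (p * q) 4; last first.
  have ge4R : 4 <= p%:R * q%:R :> R by rewrite -natrM ler_nat.
  (* Since p q >= 4, the invariant yields 2 A <= q B for odd k and 2 B <= p A for even k. Hence the
     coefficient that the next reflection replaces, A by q B - A or B by p A - B, does not
     decrease. *)
  have [A [B [A0 B0 _ e]]] : exists A B : R, [/\ 0 <= A, 0 <= B,
     (if odd k then p%:R * A <= 2 * B else q%:R * B <= 2 * A) &
     act D (ralt j i k) (a i) = A *: a i + B *: a j]; last by exists A, B.
  elim: k {km} => [|k [A [B [A0 B0 AB e]]]] /=.
    by exists 1, 0; split; rewrite // mulr0 mulr1 ler0n.
  rewrite e; case: (odd k) AB => /= AB.
    exists (q%:R * B - A), B; rewrite stepi; split=> //; nra.
  exists A, (p%:R * A - B); rewrite stepj; split=> //; nra.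
pose n : R := p%:R * q%:R.
have bn m : bond n m -> (k < m)%N.
  by move=> b; apply: km; rewrite ep eq mulrNN.
have en : n = (p * q)%:R by rewrite natrM.
have : [\/ n = 0 /\ (k < 2)%N, n = 1 /\ (k < 3)%N, n = 2 /\ (k < 4)%N |
          n = 3 /\ (k < 6)%N].
  have : (p * q = 0 \/ p * q = 1 \/ p * q = 2 \/ p * q = 3)%N by lia.
  rewrite {}en in bn *; move=> [e|[e|[e|e]]]; rewrite {}e in bn *.
  - by constructor 1; split=> //; apply: bn; constructor 1.
  - by constructor 2; split=> //; apply: bn; constructor 2.
  - by constructor 3; split=> //; apply: bn; constructor 3.
  - by constructor 4; split=> //; apply: bn; constructor 4.
move=> {km bn en lt4} h.
have k6 : (k < 6)%N by case: h => [] [_ ?]; lia.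
have n0 : 0 <= n by case: h => [] [-> _].
have val k' x y : k = k' ->
    act D (ralt j i k') (1 *: a i + 0 *: a j) = x *: a i + y *: a j ->
    0 <= x /\ 0 <= y -> exists A B : R, [/\ 0 <= A, 0 <= B &
      act D (ralt j i k) (a i) = A *: a i + B *: a j].
  by move=> -> e [x0 y0]; exists x, y; split=> //; rewrite -e -ei.
(* The coefficients are polynomials in n = p q, with an extra factor p on a_j. They are nonnegative
   for those n that admit an alternating word of length k: n - 2, for instance, occurs only when n
   >= 2. *)
have [e|[e|[e|[e|[e|e]]]]] :
  (k = 0 \/ k = 1 \/ k = 2 \/ k = 3 \/ k = 4 \/ k = 5)%N by lia.
- apply: (val _ 1 0 e) => //; rewrite ler01; lra.
- apply: (val _ 1 p%:R e); first by rewrite /= stepj; congr (_ *: _ + _ *: _); ring.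
  by rewrite ler01.
- apply: (val _ (n - 1) p%:R e).
    by rewrite /= stepj stepi; congr (_ *: _ + _ *: _); rewrite /n; ring.
  by split=> //; case: h => [] [-> ?]; [lia|lra..].
- apply: (val _ (n - 1) (p%:R * (n - 2)) e).
    by rewrite /= !(stepj, stepi); congr (_ *: _ + _ *: _); rewrite /n; ring.
  by split=> //; case: h => [] [-> ?]; [lia|lia|lra..|lia|lia|nra|nra].
- apply: (val _ (n * n - 3 * n + 1) (p%:R * (n - 2)) e).
    by rewrite /= !(stepj, stepi); congr (_ *: _ + _ *: _); rewrite /n; ring.
  by split=> //; case: h => [] [-> ?]; [lia|lia|lia|lra|lia|lia|lia|nra].
- apply: (val _ (n * n - 3 * n + 1) (p%:R * (n * n - 4 * n + 3)) e).
    by rewrite /= !(stepj, stepi); congr (_ *: _ + _ *: _); rewrite /n; ring.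
  by split=> //; case: h => [] [-> ?]; [lia|lia|lia|lra|lia|lia|lia|nra].
Qed.

(* Deodhar's argument: among the factorisations of [w] as [v] followed by an
   alternating word in the last letter of [w] and [i], take the one with the
   longest alternating part; then [v] maps both simple vectors into the cone. *)
Lemma act_cone w i :
  (forall w', ceq c w w' -> (size w <= size w')%N) ->
  (forall w', ceq c (w ++ [:: i]) w' -> (size w <= size w')%N) ->
  cone a (act D w (a i)).
Proof.
have [N] := ubnP (size w); elim: N w i => // N IH w i sw red_w red_wi.
case/lastP: w => [|w1 j] in sw red_w red_wi *; first exact: cone_gen.
have neq_ij : i != j.
  apply/eqP => eij; suff h : ceq c (rcons w1 j ++ [:: i]) w1.
    by have := red_wi _ h; rewrite size_rcons ltnn.
  have := ceq_ctx w1 [::] (ceq_inv c i); rewrite /= !cats0.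
  by rewrite -{1}eij -cats1 -catA.
set w := rcons w1 j in sw red_w red_wi *.
pose fact k := exists v, (size v + k = size w)%N /\ ceq c w (v ++ ralt j i k).
have fact1 : `[< fact 1 >].
  apply/asboolP; exists w1; split; first by rewrite size_rcons addn1.
  by rewrite /= cats1; exact: ceq_refl.
have fact_le k : `[< fact k >] -> (k <= size w)%N.
  by move/asboolP => [v [<- _]]; rewrite leq_addl.
have [k /asboolP[v [sv ewv]] max_k] := ex_maxnP (ex_intro (fun k => `[< fact k >]) _ fact1) fact_le.
have k1 : (0 < k)%N by apply: max_k.
(* [lst] is the letter with which the alternating part begins, [nxt] the letter that would prolong
   it. A word shorter than [v] for [v] followed by [lst] would shorten [w]; such a word for [v]
   followed by [nxt] would allow a longer alternating part. *)
pose nxt := if odd k then i else j.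
pose lst := if odd k then j else i.
have red_v w' : ceq c v w' -> (size v <= size w')%N.
  move=> e; have : (size w <= size (w' ++ ralt j i k))%N.
    apply: red_w; apply: ceq_trans ewv _.
    exact: (ceq_ctx [::] (ralt j i k) e).
  by rewrite size_cat size_ralt -sv leq_add2r.
have ek : ralt j i k = lst :: ralt j i k.-1.
  by case: (k) k1 @lst => //= k' _; rewrite if_neg; case: (odd k').
have red_lst w' : ceq c (v ++ [:: lst]) w' -> (size v <= size w')%N.
  move=> e; have : (size w <= size (w' ++ ralt j i k.-1))%N.
    apply: red_w; apply: ceq_trans ewv _; rewrite ek -cat1s catA.
    exact: (ceq_ctx [::] (ralt j i k.-1) e).
  by rewrite size_cat size_ralt; lia.
have red_nxt w' : ceq c (v ++ [:: nxt]) w' -> (size v <= size w')%N.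
  move=> e; rewrite leqNgt; apply/negP => lt_w'.
  have ew : ceq c w (w' ++ ralt j i k.+1).
    apply: ceq_trans ewv _.
    apply: (@ceq_trans _ _ _ _ (v ++ [:: nxt; nxt] ++ ralt j i k)).
      apply: ceq_sym; have := ceq_ctx v (ralt j i k) (ceq_inv c nxt).
      by rewrite cat0s.
    have := ceq_ctx [::] (ralt j i k.+1) e; rewrite /= -/nxt -catA /=; exact.
  have := red_w _ ew; rewrite size_cat /= size_ralt => le_w'.
  have : (k.+1 <= k)%N; last by rewrite ltnn.
  by apply: max_k; apply/asboolP; exists w'; split=> //; lia.
have cone_v l : l = i \/ l = j -> cone a (act D v (a l)).
  move=> hl; apply: IH => //; first by move: sw sv k1; lia.
  move=> w'; have [->|->] : l = nxt \/ l = lst; last 2 first.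
  - exact: red_nxt.
  - exact: red_lst.
  by rewrite /nxt /lst; case: (odd k) hl => -[]->; [left|right|right|left].
have [|A [B [A0 B0 e]]] := @ralt_cone i j k neq_ij.
  (* If the alternating part had m letters or more, the braid relation would make [w] end in i, and
     [w] followed by i would have a word shorter than [w]. *)
  move=> m b; rewrite ltnNge; apply/negP => le_mk.
  have m0 : (0 < m)%N by case: b => [] [_ ->].
  have [u su eu] := ralt_cat j i (k - m) m; rewrite subnK // in eu.
  have := red_wi (v ++ u ++ ralt j i m.-1).
  rewrite !size_cat size_ralt -sv su.
  suff h : ceq c (w ++ [:: i]) (v ++ u ++ ralt j i m.-1).
    by move=> /(_ h); lia.
  apply: (@ceq_trans _ _ _ _ ((v ++ u ++ ralt j i m) ++ [:: i])).
    by rewrite -eu; exact: (ceq_ctx [::] [:: i] ewv).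
  apply: (@ceq_trans _ _ _ _ ((v ++ u ++ ralt i j m) ++ [:: i])).
    have := ceq_ctx (v ++ u) [:: i] (ceq_braid neq_ij b).
    by rewrite -!catA.
  have -> : ralt i j m = ralt j i m.-1 ++ [:: i].
    by rewrite cats1 -ralt_rcons prednK.
  have := ceq_ctx (v ++ u ++ ralt j i m.-1) [::] (ceq_inv c i).
  by rewrite -!catA /= !cats0.
have -> : act D w (a i) = act D v (act D (ralt j i k) (a i)).
  by rewrite (act_ceq D c_gcm _ ewv) act_cat.
rewrite e !actE; apply: coneD; apply: coneZ => //; apply: cone_v; tauto.
Qed.

Lemma ex_reduced w : exists2 w', ceq c w w' &
  forall w'', ceq c w' w'' -> (size w' <= size w'')%N.
Proof.
have ex : exists n, `[< exists2 w', ceq c w w' & size w' = n >].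
  by exists (size w); apply/asboolP; exists w => //; exact: ceq_refl.
have [n /asboolP[w' ew' <-] min_n] := ex_minnP ex.
exists w' => // w'' e; apply: min_n; apply/asboolP; exists w'' => //.
exact: ceq_trans ew' e.
Qed.

(** Of the reduced words for w and for w followed by i, the shorter one satisfies the hypotheses of
    [act_cone]. Passing from one to the other changes the sign, because s_i negates a_i. *)
Lemma act_vec_sign w i : cone a (act D w (a i)) \/ cone a (- act D w (a i)).
Proof.
have [w1 e1 red1] := ex_reduced w.
have [w2 e2 red2] := ex_reduced (w1 ++ [:: i]).
rewrite (act_ceq D c_gcm _ e1).
have [le12|lt21] := leqP (size w1) (size w2).
  left; apply: act_cone => // w' e; apply: leq_trans le12 _; apply: red2.
  exact: ceq_trans (ceq_sym e2) e.
have e3 : ceq c w1 (w2 ++ [:: i]).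
  apply: (@ceq_trans _ _ _ _ (w1 ++ [:: i; i])).
    apply: ceq_sym; have := ceq_ctx w1 [::] (ceq_inv c i).
    by rewrite /= !cats0.
  have := ceq_ctx [::] [:: i] e2; rewrite /= -catA; exact.
right; rewrite (act_ceq D c_gcm _ e3) act_cat /= srefl_vec // actN opprK.
apply: act_cone => // w' e; apply: leq_trans (ltnW lt21) _; apply: red1.
exact: ceq_trans e3 e.
Qed.

(** A nonempty reduced word makes the simple vector of its last letter negative. This is the way
    back from vectors to words on which every transfer rests. *)
Lemma ceq_nil_cone w :
  (forall v, cone a v -> cone a (- v) -> v = 0) ->
  (forall i, cone a (act D w (a i))) -> ceq c w [::].
Proof.
move=> salient pos_w; have [w1 e1 red1] := ex_reduced w.
case/lastP: w1 => [|u i] in e1 red1 *; first by [].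
exfalso; have red_u w' : ceq c u w' -> (size u <= size w')%N.
  move=> e; have := red1 (rcons w' i); rewrite !size_rcons ltnS; apply.
  by rewrite -!cats1; exact: (ceq_ctx [::] [:: i] e).
have cu : cone a (act D u (a i)).
  apply: act_cone => // w' e; apply: (@leq_trans (size (rcons u i))).
    by rewrite size_rcons.
  by apply: red1; rewrite -cats1.
have := pos_w i; rewrite (act_ceq D c_gcm _ e1) act_rcons srefl_vec // actN => cNu.
have ai0 : a i = 0 by apply: (act_inj c_gcm (w := u)); rewrite act0; exact: salient cu cNu.
have := rform_vec D i i; rewrite ai0 rform0 (gcm_diag c_gcm).
by move/esym/eqP; rewrite pnatr_eq0.
Qed.

End Positivity.

(** * Transfer between realizations *)

Definition salient (R : realType) (V : lmodType R) (I : Type) (a : I -> V) :=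
  forall v, cone a v -> cone a (- v) -> v = 0.

Lemma ceq_tr (R : realType) (I : eqType) (c : I -> I -> R) w w' :
  ceq c w w' -> ceq (fun i j => c j i) w w'.
Proof.
elim=> [{}w|{}w {}w' _|{}w {}w' w'' _ + _|u v {}w {}w' _|i|i j m neq_ij b].
- exact: ceq_refl.
- exact: ceq_sym.
- exact: ceq_trans.
- exact: ceq_ctx.
- exact: ceq_inv.
- by apply: ceq_braid; rewrite // mulrC.
Qed.

Section Transfer.
Variables (R : realType) (I : eqType) (c : I -> I -> R) (V : lmodType R).
Variable D : realization c V.
Hypothesis c_gcm : gcm c.

Local Notation a := (rvec D).

(** Pairings are computed from [c] alone, although the vectors may satisfy different linear
    relations in the two realizations. *)
Lemma rform_act_eq (U : lmodType R) (E : realization c U) w i k :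
  rform E k (act E w (rvec E i)) = rform D k (act D w (a i)).
Proof.
elim: w k => [|m w IH] k /=; first by rewrite !rform_vec.
by rewrite !rformB !rformZ !rform_vec !IH.
Qed.

Lemma rform_act_tr (U : lmodType R) (E : realization (fun i j => c j i) U) w i k :
  rform E k (act E w (rvec E i)) = rform D i (act D (rev w) (a k)).
Proof.
elim: w k => [|m w IH] k /=; first by rewrite !rform_vec.
rewrite rformB rformZ rform_vec !IH rev_cons act_rcons /srefl !actE rformB rformZ.
by rewrite rform_vec mulrC.
Qed.

Lemma rvec_neq0 i : a i != 0.
Proof.
apply/eqP => ai0; have := rform_vec D i i; rewrite ai0 rform0 (gcm_diag c_gcm).
by move/esym/eqP; rewrite pnatr_eq0.
Qed.

Hypothesis a_salient : salient a.

(** A substitute for the coordinate along a_j: all terms other than multiples of a_j have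
    nonpositive value under the j-th form. *)
Lemma cone_split j v : cone a v ->
  exists y v', [/\ 0 <= y, cone a v', rform D j v' <= 0 & v = y *: a j + v'].
Proof.
elim=> [|x i {}v x0 _ [y [v' [y0 cv' le0 ->]]]].
  by exists 0, 0; rewrite rform0 scale0r add0r; split=> //; apply: cone0.
have [->|neq_ij] := eqVneq i j.
  by exists (x + y), v'; rewrite scalerDl addrA; split=> //; apply: addr_ge0.
exists y, (x *: a i + v'); rewrite addrCA; split=> //; first exact: coneA.
rewrite rformD rformZ rform_vec; have := gcm_le0 c_gcm neq_ij; nra.
Qed.

(** The ray of a_j is a face of the cone. Once the multiples of a_j are split off, the remainders
    add up to t a_j. The j-th form excludes t > 0, and for t <= 0 salience makes the remainder of p
    vanish. *)
Lemma cone_face j p q x : cone a p -> cone a q -> p + q = x *: a j ->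
  exists2 y, 0 <= y & p = y *: a j.
Proof.
move=> /(cone_split j)[y [p' [y0 cp' p'0 ->]]] /(cone_split j)[z [q' [z0 cq' q'0 ->]]] e.
have {}e : p' + q' = (x - y - z) *: a j.
  rewrite addrACA -scalerDl in e.
  by rewrite -addrA -opprD scalerBl -e [RHS]addrC addKr.
have [xyz|xyz] := lerP 0 (x - y - z).
  have : rform D j (p' + q') = 2 * (x - y - z).
    by rewrite e rformZ rform_vec (gcm_diag c_gcm) mulrC.
  rewrite rformD => e'; have xyz0 : x - y - z = 0 by lra.
  exists y => //; rewrite [p'](a_salient cp') ?addr0 //.
  by move/eqP: e; rewrite xyz0 scale0r addrC addr_eq0 => /eqP <-.
exists y => //; rewrite [p'](a_salient cp') ?addr0 //.
have -> : - p' = q' + (y + z - x) *: a j.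
  have -> : y + z - x = - (x - y - z) by ring.
  by rewrite scaleNr -e opprD [RHS]addrC subrK.
by apply: coneD => //; apply: coneZ; [lra|exact: cone_gen].
Qed.

(* [w s_i w^-1 s_j] adds to each vector a multiple of [a_j] and fixes [a_j], so
   it makes no simple vector negative. *)
Lemma act_simple_conj w i j x : act D w (a i) = x *: a j ->
  ceq c (w ++ i :: rev w ++ [:: j]) [::].
Proof.
move=> e; have x0 : x != 0.
  apply/eqP => x0; have /eqP := rvec_neq0 i; apply.
  by apply: (act_inj (D := D) c_gcm (w := w)); rewrite e x0 scale0r act0.
have einv : act D (rev w) (a j) = x^-1 *: a i.
  by rewrite -(act_revK D c_gcm w (a i)) e actZ scalerA mulVf // scale1r.
set u := _ ++ _; have actu v : act D u v = srefl D j v -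
    (x * rform D i (act D (rev w) (srefl D j v))) *: a j.
  rewrite /u -(cat_cons i) catA act_cat /= act_refl // e scalerA.
  by rewrite mulrC.
apply: (ceq_nil_cone (D := D)) => // k.
have [->|neq_kj] := eqVneq k j.
  rewrite actu srefl_vec // actN einv rformN rformZ rform_vec (gcm_diag c_gcm).
  rewrite mulrN mulrA mulfV // mul1r scaleNr opprK scaler_nat mulr2n addKr.
  exact: cone_gen.
have [//|cN] := act_vec_sign D c_gcm u k.
have [f ef] : exists f, act D u (a k) = a k - f *: a j.
  eexists; rewrite actu {1}/srefl -addrA -opprD -scalerDl; reflexivity.
(* If [u] made a_k negative, a_k would be y a_j with y >= 0, and the j-th form would give 2 y = c_kj
   <= 0. *)
have [|y y0 ek] := @cone_face j (a k) _ f (cone_gen _ _) cN.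
  by rewrite ef opprB addrC subrK.
have /eqP := rform_vec D k j; rewrite ek rformZ rform_vec (gcm_diag c_gcm).
have := gcm_le0 c_gcm neq_kj => ckj /eqP ey.
have {}y0 : y = 0 by lra.
by have /eqP := rvec_neq0 k; rewrite ek y0 scale0r.
Qed.

(** In [E] the relation w s_i w^-1 s_j = 1 says that the reflection along w(a_i) negates a_j, so
    that a_j is a multiple of w(a_i). The factor is half a pairing, hence the same in both
    realizations. *)
Lemma act_transfer (U : lmodType R) (E : realization c U) w i j x :
  act D w (a i) = x *: a j -> act E w (rvec E i) = x *: rvec E j.
Proof.
move=> e; have h := act_simple_conj e.
have x0 : x != 0.
  apply/eqP => x0; have /eqP := rvec_neq0 i; apply.
  by apply: (act_inj (D := D) c_gcm (w := w)); rewrite e x0 scale0r act0.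
have einv : act D (rev w) (a j) = x^-1 *: a i.
  by rewrite -(act_revK D c_gcm w (a i)) e actZ scalerA mulVf // scale1r.
have := act_ceq E c_gcm (rvec E j) h.
rewrite -(cat_cons i) catA act_cat /= act_refl // srefl_vec // actN rformN.
rewrite rform_act_eq einv rformZ rform_vec (gcm_diag c_gcm) scaleNr opprK /=.
move/(congr1 (fun v => (x / 2) *: (rvec E j + v))).
rewrite addNKr scalerA -mulr2n -scaler_nat scalerA divfK ?pnatr_eq0 //.
by rewrite (_ : x / 2 * (x^-1 * 2) = 1) ?scale1r //; field.
Qed.

(** The same argument, but the pairing is now computed by adjointness, which puts the factor x on
    the other side: coroots scale inversely to roots. *)
Lemma act_transfer_tr (U : lmodType R) (E : realization (fun i j => c j i) U)
    w i j x :
  act D w (a i) = x *: a j -> x *: act E w (rvec E i) = rvec E j.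
Proof.
move=> e; have h := act_simple_conj e.
have gcm' := gcm_tr c_gcm.
have := act_ceq E gcm' (rvec E j) (ceq_tr h).
rewrite -(cat_cons i) catA act_cat /= act_refl // srefl_vec // actN rformN.
rewrite rform_act_tr revK e rformZ rform_vec (gcm_diag c_gcm) scaleNr opprK /=.
move/(congr1 (fun v => 2^-1 *: (rvec E j + v))).
rewrite addNKr scalerA -mulr2n -scaler_nat scalerA mulVf ?pnatr_eq0 // scale1r => <-.
by rewrite mulrCA mulVf ?pnatr_eq0 // mulr1.
Qed.

End Transfer.

(** * The free realization *)

Section FreeRealization.
Variables (R : realType) (I : choiceType).

Lemma fglift_scalable (M : lmodType R) (f : I -> M) (x : R) (v : {freeg I / R}) :
  fglift f (x *: v) = x *: fglift f v.
Proof.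
have fB := lift_is_additive f.
have f0 : fglift f 0 = 0 by have := fB 0 0; rewrite !subrr.
have fD u w : fglift f (u + w) = fglift f u + fglift f w.
  by rewrite -[w in LHS]opprK fB -[- w]sub0r fB f0 sub0r opprK.
rewrite -[v]freeg_sumE; elim: (dom v) => [|z s IH]; first by rewrite !big_nil scaler0 f0 scaler0.
rewrite !big_cons scalerDr !fD IH scalerDr; congr (_ + _).
have -> : x *: << coeff z v *g z >> = << x * coeff z v *g z >> :> {freeg I / R}.
  by apply/eqP/freeg_eqP => y; rewrite coeffZ !coeffU mulrA.
by rewrite !liftU scalerA.
Qed.

Variable c : I -> I -> R.

Lemma free_form_scalar j :
  scalar (fun v : {freeg I / R} => fglift (fun i => c i j : R^o) v : R).
Proof.
move=> x u v; have fB := lift_is_additive (fun i => c i j : R^o).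
rewrite -[v in LHS]opprK fB fglift_scalable; congr (_ + _).
have := fB 0 v; rewrite sub0r => ->.
by have := fB 0 0; rewrite !subrr => ->; rewrite sub0r opprK.
Qed.

Lemma free_form_vec i j :
  fglift (fun i => c i j : R^o) (<< i >> : {freeg I / R}) = c i j.
Proof. by rewrite liftU scale1r. Qed.

Definition free_real : realization c {freeg I / R} :=
  Realization free_form_scalar free_form_vec.

Lemma coeff_free_act_int w i k : gcm c ->
  coeff k (act free_real w << i >>) \is a Num.int.
Proof.
move=> c_gcm; elim: w => [|m w IH] /=; first by rewrite coeffU mul1r natr_int.
rewrite coeffB coeffZ rpredB // rpredM //; first exact: rform_act_int.
by rewrite coeffU mul1r natr_int.
Qed.

End FreeRealization.

(** * Integrality and reducedness *)

Section Reduced.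
Variables (R : realType) (I : choiceType) (c : I -> I -> R) (V : lmodType R).
Variable D : realization c V.
Hypothesis c_gcm : gcm c.
Hypothesis a_salient : salient (rvec D).

Local Notation a := (rvec D).

(** In the free realization x is a genuine coordinate, and words in the reflections preserve
    integral coordinates there. *)
Lemma act_vec_int w i j x : act D w (a i) = x *: a j -> x \is a Num.int.
Proof.
move=> /(act_transfer c_gcm a_salient (free_real c)) e.
have := coeff_free_act_int w i j c_gcm; rewrite e coeffZ coeffU eqxx.
by rewrite !mulr1.
Qed.

(** Both x and x^-1 are integers, by the word and its reverse, and x = -1 would put a_j and its
    opposite in the cone. *)
Lemma act_vec_reduced w i j x : cone a (act D w (a i)) ->
  act D w (a i) = x *: a j -> x = 1.
Proof.
move=> cw e; have x0 : x != 0.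
  apply/eqP => x0; have /eqP := rvec_neq0 D c_gcm i; apply.
  by apply: (act_inj (D := D) c_gcm (w := w)); rewrite e x0 scale0r act0.
have einv : act D (rev w) (a j) = x^-1 *: a i.
  by rewrite -(act_revK D c_gcm w (a i)) e actZ scalerA mulVf // scale1r.
have x_ge1 : 1 <= `|x| by rewrite norm_intr_ge1 // (act_vec_int e).
have : 1 <= `|x^-1| by rewrite norm_intr_ge1 ?invr_eq0 // (act_vec_int einv).
rewrite normfV invf_ge1 ?normr_gt0 // => x_le1.
have [x_ge0|x_lt0] := lerP 0 x; first by rewrite ger0_norm // in x_ge1 x_le1; lra.
have /eqP [] := rvec_neq0 D c_gcm j; apply: a_salient; first exact: cone_gen.
rewrite ltr0_norm // in x_ge1 x_le1.
by rewrite -scaleN1r (_ : -1 = x) -?e //; lra.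
Qed.

(** Otherwise w(a_i) and the opposite of its image would be cone elements whose sum is a multiple of
    a_j. By [cone_face] and reducedness w(a_i) would then be a_j. *)
Lemma srefl_act_cone w i j : cone a (act D w (a i)) -> act D w (a i) <> a j ->
  cone a (srefl D j (act D w (a i))).
Proof.
move=> cw neq; have [//|cN] := act_vec_sign D c_gcm (j :: w) i.
have [|y y0 e] := @cone_face _ _ _ _ D c_gcm a_salient j _ _ (rform D j (act D w (a i))) cw cN.
  by rewrite /= /srefl opprB addrC subrK.
by case: neq; rewrite e (act_vec_reduced cw e) scale1r.
Qed.

End Reduced.

(** * Roots and coroots of a based root datum *)

Section PosCone.
Variables (R : realType) (V : lmodType R) (G : set V).

Lemma fsbig_seq_supp (c : V -> R) (r : seq V) : uniq r ->
  (forall a, a \in r -> G a) -> (forall a, G a -> c a != 0 -> a \in r) ->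
  \sum_(a \in G) c a *: a = \sum_(a <- r) c a *: a.
Proof.
move=> r_uniq rG cr; rewrite (fsbigE r) //; last first.
  move=> a Ga; apply: contraNeq => ca0; apply: cr => //.
  by apply: contraNneq ca0 => ->; rewrite scale0r.
rewrite big_seq_cond [RHS]big_seq; apply: eq_bigl => a.
by case ar: (a \in r) => //=; apply: mem_set; exact: rG.
Qed.

Lemma fin_supp_seq (c : V -> R) : finite_set [set a | G a /\ c a != 0] ->
  exists2 r : seq V, (forall a, a \in r -> G a) & forall a, G a -> c a != 0 -> a \in r.
Proof.
move=> fin_c; exists (finmap.enum_fset (fset_set [set a | G a /\ c a != 0])).
  by move=> a; rewrite in_fset_set // => /set_mem[].
by move=> a Ga ca; rewrite in_fset_set //; exact: mem_set.
Qed.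

Lemma pos_combD (c d : V -> R) :
  finite_set [set a | G a /\ c a != 0] -> finite_set [set a | G a /\ d a != 0] ->
  finite_set [set a | G a /\ c a + d a != 0] /\
  \sum_(a \in G) (c a + d a) *: a = \sum_(a \in G) c a *: a + \sum_(a \in G) d a *: a.
Proof.
move=> fin_c fin_d; split.
  apply: (@sub_finite_set _ _ ([set a | G a /\ c a != 0] `|` [set a | G a /\ d a != 0])).
    move=> a [Ga]; have [c0|] := eqVneq (c a) 0; last by left.
    by rewrite c0 add0r; right.
  by rewrite finite_setU.
have [r rG cr] := fin_supp_seq fin_c; have [s sG ds] := fin_supp_seq fin_d.
rewrite !(@fsbig_seq_supp _ (undup (r ++ s))) ?undup_uniq //.
- by rewrite -big_split; apply: eq_bigr => a _; rewrite scalerDl.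
- by move=> a; rewrite mem_undup mem_cat => /orP[/rG|/sG].
- by move=> a Ga da; rewrite mem_undup mem_cat ds // orbT.
- by move=> a; rewrite mem_undup mem_cat => /orP[/rG|/sG].
- by move=> a Ga ca; rewrite mem_undup mem_cat cr.
- by move=> a; rewrite mem_undup mem_cat => /orP[/rG|/sG].
- move=> a Ga; rewrite mem_undup mem_cat; have [c0|ca _] := eqVneq (c a) 0.
    by rewrite c0 add0r => da; rewrite ds // orbT.
  by rewrite cr.
Qed.

Lemma pos_cone_gen x a : 0 <= x -> G a -> pos_cone G (x *: a).
Proof.
move=> x0 Ga; exists (fun b => if b == a then x else 0); split.
- by move=> b _; case: ifP.
- apply: (@sub_finite_set _ _ [set a]); last exact: finite_set1.
  by move=> b [_] /=; case: (b =P a) => [//|_]; rewrite eqxx.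
- rewrite (@fsbig_seq_supp _ [:: a]) //.
  + by rewrite big_seq1 eqxx.
  + by move=> b; rewrite inE => /eqP ->.
  + by move=> b _; rewrite inE; case: (b =P a) => [//|_]; rewrite eqxx.
Qed.

Lemma pos_coneD u v : pos_cone G u -> pos_cone G v -> pos_cone G (u + v).
Proof.
move=> [c [c0 fin_c ->]] [d [d0 fin_d ->]]; exists (fun a => c a + d a).
have [fin_cd e] := pos_combD fin_c fin_d; split=> //.
by move=> a Ga; apply: addr_ge0; [exact: c0|exact: d0].
Qed.

Lemma pos_cone0 : pos_cone G 0.
Proof.
exists (fun=> 0); split=> //; last first.
  by rewrite fsbig1 // => a _; rewrite scale0r.
by rewrite (_ : mkset _ = set0) //; apply/seteqP; split=> a //= [_] /=; rewrite eqxx.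
Qed.

Lemma cone_pos_cone (I : Type) (a : I -> V) v : (forall i, pos_cone G (a i)) ->
  cone a v -> pos_cone G v.
Proof.
move=> aG; elim=> [|x i {}v x0 _ IH]; first exact: pos_cone0.
apply: pos_coneD => //; have [c [c0 fin_c ->]] := aG i.
have [r rG cr] := fin_supp_seq fin_c.
rewrite (@fsbig_seq_supp _ (undup r)) ?undup_uniq //; last 2 first.
- by move=> b; rewrite mem_undup => /rG.
- by move=> b Gb cb; rewrite mem_undup cr.
rewrite big_seq_cond scaler_sumr; elim/big_ind: _ => //.
- exact: pos_cone0.
- exact: pos_coneD.
- move=> b; rewrite mem_undup andbT => /rG Gb; rewrite scalerA.
  by apply: pos_cone_gen => //; apply: mulr_ge0 => //; apply: c0.
Qed.

Lemma pos_cone_cone v : pos_cone G v -> cone (val : G -> V) v.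
Proof.
move=> [c [c0 fin_c ->]]; have [r rG cr] := fin_supp_seq fin_c.
rewrite (@fsbig_seq_supp _ (undup r)) ?undup_uniq //; last 2 first.
- by move=> b; rewrite mem_undup => /rG.
- by move=> b Gb cb; rewrite mem_undup cr.
rewrite big_seq_cond; elim/big_ind: _ => //.
- exact: cone0.
- exact: coneD.
- move=> b; rewrite mem_undup andbT => /rG Gb.
  by apply: coneZ; [exact: c0|exact: (cone_gen (val : G -> V) (SigSub (mem_set Gb)))].
Qed.

Lemma pos_coneZ x v : 0 <= x -> pos_cone G v -> pos_cone G (x *: v).
Proof.
move=> x0 /pos_cone_cone/(coneZ x0); apply: cone_pos_cone => a.
by rewrite -[val a]scale1r; apply: pos_cone_gen => //; exact: set_valP.
Qed.

(** Positive independence enters the Coxeter arguments through this property of the cone. *)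
Lemma pos_indep_salient v : pos_indep G -> pos_cone G v -> pos_cone G (- v) -> v = 0.
Proof.
move=> indep [c [c0 fin_c ev]] [d [d0 fin_d eNv]].
have [fin_cd e] := pos_combD fin_c fin_d; rewrite -ev -eNv subrr in e.
have cd0 : forall a, G a -> c a + d a = 0.
  by apply: indep => // a Ga; apply: addr_ge0; [exact: c0|exact: d0].
rewrite ev fsbig1 // => a Ga; suff -> : c a = 0 by rewrite scale0r.
by have := cd0 a Ga; have := c0 a Ga; have := d0 a Ga; lra.
Qed.

End PosCone.

Section Words.
Variables (R : realType) (I : eqType) (c : I -> I -> R) (V : lmodType R).
Variable D : realization c V.
Hypothesis c_gcm : gcm c.

Lemma gen_group_words (S : set (V -> V)) :
  S = [set srefl D i | i in [set: I]] -> gen_group S = [set act D w | w in setT].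
Proof.
move=> ->; apply/seteqP; split.
  apply: smallest_sub; last first.
    by move=> _ [i _ <-]; exists [:: i] => //; apply/funext.
  split; first by exists [::] => //; apply/funext.
    move=> _ _ [w _ <-] [w' _ <-]; exists (w ++ w') => //.
    by apply/funext => v; rewrite act_cat.
  move=> _ g [w _ <-] _ gK; exists (rev w) => //.
  by apply/funext => v; rewrite -[v in LHS]gK act_revK.
move=> _ [w _ <-] G [[Gid Gcomp _] SG]; elim: w => [|i w IH]; first exact: Gid.
by apply: (Gcomp (srefl D i)) => //; apply: SG; exists i.
Qed.

End Words.

(** * Coroots, Cartan integers and signs of roots *)

Section BasedRootDatum.
Variables (R : realType) (V V' : lmodType R) (B : rootdata V V').
Hypothesis hB : crystallographic B.

Local Notation simple := (set_type (simple_roots B)).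
Local Notation "<< v , u >>" := (root_pairing B v u).

Definition simple_cartan (i j : simple) : R := << val i, simple_iota B (val j) >>.

Lemma simple_gcm : gcm simple_cartan.
Proof.
have neq_val (i j : simple) : i != j -> val i <> val j.
  by move=> /eqP neq_ij e; apply/neq_ij/val_inj.
have diag (i : simple) : simple_cartan i i = 2 by exact/(cr_diag hB)/set_valP.
have offdiag (i j : simple) (neq_ij : i != j) :=
  cr_offdiag hB (set_valP i) (set_valP j) (neq_val i j neq_ij).
split=> // [i j|i j /offdiag[]//|i j].
  by have [->|/offdiag[]//] := eqVneq i j; rewrite diag rpred_nat.
by have [->//|/offdiag[_ _ [h _]]] := eqVneq i j; exact: h.
Qed.

Definition root_real : realization simple_cartan V :=
  @Realization _ _ simple_cartan _ val (fun i v => << v, simple_iota B (val i) >>)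
    (fun i => (cr_bilinear hB).1 (simple_iota B (val i)))
    (fun i j => erefl).

Definition coroot_real : realization (fun i j => simple_cartan j i) V' :=
  @Realization _ _ (fun i j => simple_cartan j i) _
    (fun i => simple_iota B (val i)) (fun i u => << val i, u >>)
    (fun i => (cr_bilinear hB).2 (val i))
    (fun i j => erefl).

Lemma root_real_salient : salient (rvec root_real).
Proof.
move=> v cv cNv; have pos i : pos_cone (simple_roots B) (rvec root_real i).
  by rewrite -[rvec _ _]scale1r; apply: pos_cone_gen => //; exact: set_valP.
by apply: (pos_indep_salient (cr_simple hB)); apply: (cone_pos_cone pos).
Qed.

Lemma coroot_real_salient : salient (rvec coroot_real).
Proof.
move=> v cv cNv; have pos i : pos_cone (simple_coroots B) (rvec coroot_real i).
  rewrite -[rvec _ _]scale1r; apply: pos_cone_gen => //.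
  by have [h _ _] := cr_iota hB; apply/h/set_valP.
by apply: (pos_indep_salient (cr_cosimple hB)); apply: (cone_pos_cone pos).
Qed.

Lemma weylE : weyl B = [set act root_real w | w in setT].
Proof.
apply: gen_group_words; first exact: simple_gcm.
apply/seteqP; split=> [_ [a Ga <-]|_ [i _ <-]]; last by exists (val i) => //; exact: set_valP.
by exists (SigSub (mem_set Ga)).
Qed.

Lemma coweylE : coweyl B = [set act coroot_real w | w in setT].
Proof.
apply: gen_group_words; first exact: gcm_tr simple_gcm.
apply/seteqP; split=> [_ [a Ga <-]|_ [i _ <-]]; last by exists (val i) => //; exact: set_valP.
by exists (SigSub (mem_set Ga)).
Qed.

Lemma root_systemP b : root_system B b <-> exists w (i : simple), b = act root_real w (val i).
Proof.
rewrite /root_system weylE; split=> [[_ [w _ <-]] [a Ga <-]|[w [i ->]]].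
  by exists w, (SigSub (mem_set Ga)).
exists (act root_real w); first by exists w.
by exists (val i) => //; exact: set_valP.
Qed.

Lemma coroot_systemP u : coroot_system B u <->
  exists w (i : simple), u = act coroot_real w (simple_iota B (val i)).
Proof.
have [iota_fun _ iota_surj] := cr_iota hB.
rewrite /coroot_system coweylE; split=> [[_ [w _ <-]] [x Gx <-]|[w [i ->]]].
  by have [a Ga <-] := iota_surj _ Gx; exists w, (SigSub (mem_set Ga)).
exists (act coroot_real w); first by exists w.
by exists (simple_iota B (val i)) => //; apply/iota_fun/set_valP.
Qed.

(** The word for w'^-1 w sends a_i to a_j with factor 1, and so does its transfer to coroots. Hence
    the coroot of a root does not depend on the word that produces the root. *)
Lemma coact_wd w w' (i j : simple) :
  act root_real w (val i) = act root_real w' (val j) ->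
  act coroot_real w (simple_iota B (val i)) = act coroot_real w' (simple_iota B (val j)).
Proof.
move=> e; have := @act_transfer_tr _ _ _ _ root_real simple_gcm root_real_salient
  _ coroot_real (rev w' ++ w) i j 1.
rewrite !act_cat !scale1r e act_revK; last exact: simple_gcm.
move=> /(_ erefl) /= <-; rewrite act_Krev //; exact: gcm_tr simple_gcm.
Qed.

Lemma coact_inj w w' (i j : simple) :
  act coroot_real w (simple_iota B (val i)) = act coroot_real w' (simple_iota B (val j)) ->
  act root_real w (val i) = act root_real w' (val j).
Proof.
move=> e; have := @act_transfer_tr _ _ _ _ coroot_real (gcm_tr simple_gcm)
  coroot_real_salient _ root_real (rev w' ++ w) i j 1.
rewrite !act_cat !scale1r e act_revK; last exact: gcm_tr simple_gcm.
move=> /(_ erefl) /= <-; rewrite act_Krev //; exact: simple_gcm.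
Qed.

Lemma ex_coroot_map : exists f, is_coroot_map B f.
Proof.
pose f (b : V) : V' := xget 0 [set u | exists w (i : simple),
  b = act root_real w (val i) /\ u = act coroot_real w (simple_iota B (val i))].
have fE w (i : simple) : f (act root_real w (val i)) = act coroot_real w (simple_iota B (val i)).
  rewrite /f; case: xgetP => [u _ [w' [j [e ->]]]|].
    exact/coact_wd/esym.
  by move=> /(_ (act coroot_real w (simple_iota B (val i)))) []; exists w, i.
exists f; split.
- by move=> a Ga; exact: (fE [::] (SigSub (mem_set Ga))).
- split.
  + by move=> b /root_systemP[w [i ->]]; apply/coroot_systemP; exists w, i; rewrite fE.
  + move=> b b' /set_mem/root_systemP[w [i ->]] /set_mem/root_systemP[w' [j ->]].
    by rewrite !fE; exact: coact_inj.
  + move=> u /coroot_systemP[w [i ->]]; exists (act root_real w (val i)).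
      by apply/root_systemP; exists w, i.
    exact: fE.
- move=> a b Ga /root_systemP[w [i ->]].
  rewrite fE; exact: (fE (SigSub (mem_set Ga) :: w) i).
Qed.

Lemma coroot_act w (i : simple) : coroot B (act root_real w (val i)) =
  act coroot_real w (simple_iota B (val i)).
Proof.
have [f_simple _ f_eqv] : is_coroot_map B (coroot B) := xgetPex _ ex_coroot_map.
elim: w => [|j w IH] /=; first exact/f_simple/set_valP.
rewrite -IH; apply: f_eqv; first exact: set_valP.
by apply/root_systemP; exists w, i.
Qed.

Lemma pairing_act w v u : << act root_real w v, act coroot_real w u >> = << v, u >>.
Proof.
elim: w => //= i w IH; rewrite /srefl /=.
have [bl br] := cr_bilinear hB.
have subl x y z t : << x - t *: y, z >> = << x, z >> - t * << y, z >>.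
  by have := bl z (- t) y x; rewrite scaleNr mulNr ![- _ + _]addrC.
have subr x y z t : << x, y - t *: z >> = << x, y >> - t * << x, z >>.
  by have := br x (- t) z y; rewrite scaleNr mulNr ![- _ + _]addrC.
rewrite !subl !subr -{}IH (cr_diag hB (set_valP i)); ring.
Qed.

Lemma pairing_scalarl u : scalar (root_pairing B ^~ u).
Proof. exact: (cr_bilinear hB).1. Qed.

Lemma root_simple a : simple_roots B a -> root_system B a.
Proof. by move=> Ga; apply/root_systemP; exists [::], (SigSub (mem_set Ga)). Qed.

Lemma coroot_simple a : simple_roots B a -> coroot B a = simple_iota B a.
Proof. by move=> Ga; exact: (coroot_act [::] (SigSub (mem_set Ga))). Qed.

Lemma root_refl_act w (i : simple) v : root_refl B (act root_real w (val i)) v =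
  act root_real (w ++ i :: rev w) v.
Proof.
rewrite act_refl; last exact: simple_gcm.
rewrite /root_refl /reflection coroot_act; congr (_ - _ *: _) => /=.
rewrite -[v in LHS](act_Krev root_real simple_gcm w); exact: pairing_act.
Qed.

Lemma cartan_diag b : root_system B b -> cartan B b b = 2.
Proof.
move=> /root_systemP[w [i ->]]; rewrite /cartan coroot_act pairing_act.
exact/(cr_diag hB)/set_valP.
Qed.

Lemma root_root_refl a b : root_system B a -> root_system B b ->
  root_system B (root_refl B a b).
Proof.
move=> /root_systemP[w [i ->]] /root_systemP[w' [j ->]]; apply/root_systemP.
by exists ((w ++ i :: rev w) ++ w'), j; rewrite root_refl_act -act_cat.
Qed.

Lemma coroot_root_refl a b : root_system B a -> root_system B b ->
  coroot B (root_refl B a b) = coreflection B a (coroot B a) (coroot B b).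
Proof.
move=> /root_systemP[w [i ->]] /root_systemP[w' [j ->]].
rewrite root_refl_act -act_cat !coroot_act act_cat act_refl; last exact: gcm_tr simple_gcm.
congr (_ - _ *: _) => /=.
rewrite -[in RHS](act_Krev coroot_real (gcm_tr simple_gcm) w (act _ w' _)).
by rewrite pairing_act.
Qed.

Lemma cartan_int a b : root_system B a -> root_system B b -> cartan B a b \is a Num.int.
Proof.
move=> /root_systemP[w [i ->]] /root_systemP[w' [j ->]].
rewrite /cartan coroot_act -(act_Krev root_real simple_gcm w' (act _ w _)) pairing_act.
by rewrite -act_cat; exact: (rform_act_int root_real simple_gcm (rev w' ++ w) i j).
Qed.

(** If s_b fixes a, equivariance makes the coreflection of b fix the coroot of a, and the coroot of
    b is not 0. The axioms state this symmetry for simple roots; canonical simple roots need it for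
    all roots. *)
Lemma cartan_eq0 a b : root_system B a -> root_system B b ->
  cartan B a b = 0 -> cartan B b a = 0.
Proof.
move=> ra rb ab0; have := coroot_root_refl rb ra.
rewrite /root_refl /reflection -/(cartan B a b) ab0 scale0r subr0 /coreflection.
move=> /esym/eqP; rewrite subr_eq addrC -subr_eq subrr => /eqP/esym/eqP; rewrite scaler_eq0.
case/orP=> /eqP // b0; have := cartan_diag rb; rewrite /cartan b0.
have := (cr_bilinear hB).2 b 0 0 0; rewrite scaler0 addr0 mul0r add0r => e.
by have := (cr_bilinear hB).2 b 1 0 0; rewrite scaler0 addr0 mul1r => ?; lra.
Qed.

Lemma root_sign b : root_system B b ->
  pos_cone (simple_roots B) b \/ pos_cone (simple_roots B) (- b).
Proof.
have pos i : pos_cone (simple_roots B) (rvec root_real i).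
  by rewrite -[rvec _ _]scale1r; apply: pos_cone_gen => //; exact: set_valP.
move=> /root_systemP[w [i ->]].
by have [] := act_vec_sign root_real simple_gcm w i => /(cone_pos_cone pos); tauto.
Qed.

Lemma simple_refl_pos a b : simple_roots B a -> positive_roots B b -> b <> a ->
  positive_roots B (root_refl B a b).
Proof.
move=> Ga [rb posb] neq_ab; split.
  by apply: root_root_refl => //; exact: root_simple.
have [w [i eb]] := (root_systemP b).1 rb.
have pos j : pos_cone (simple_roots B) (rvec root_real j).
  by rewrite -[rvec _ _]scale1r; apply: pos_cone_gen => //; exact: set_valP.
have := @srefl_act_cone _ _ _ _ root_real simple_gcm root_real_salient w i (SigSub (mem_set Ga)).
rewrite -eb => /(_ (pos_cone_cone posb) neq_ab) /(cone_pos_cone pos).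
by rewrite /root_refl (coroot_simple Ga).
Qed.

Lemma root_reflD a u v : root_refl B a (u + v) = root_refl B a u + root_refl B a v.
Proof.
rewrite /root_refl /reflection; have := pairing_scalarl (coroot B a) 1 u v.
rewrite scale1r mul1r => ->; by rewrite scalerDl opprD addrACA.
Qed.

Lemma root_reflZ a x v : root_refl B a (x *: v) = x *: root_refl B a v.
Proof.
rewrite /root_refl /reflection; have e0 : << 0, coroot B a >> = 0.
  by have := pairing_scalarl (coroot B a) 1 0 0; rewrite scaler0 addr0 mul1r => ?; lra.
have := pairing_scalarl (coroot B a) x v 0.
by rewrite !addr0 e0 addr0 => ->; rewrite scalerBr scalerA.
Qed.

Lemma root_reflN a v : root_refl B a (- v) = - root_refl B a v.
Proof. by rewrite -scaleN1r root_reflZ scaleN1r. Qed.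

Lemma root_refl_self a : root_system B a -> root_refl B a a = - a.
Proof.
move=> ra; rewrite /root_refl /reflection -/(cartan B a a) cartan_diag //.
by rewrite scaler_nat mulr2n opprD addrA subrr add0r.
Qed.

Lemma root_reflK a : root_system B a -> involutive (root_refl B a).
Proof.
move=> ra v; rewrite {2}/root_refl /reflection root_reflD -scaleNr root_reflZ.
by rewrite root_refl_self // scaleNr scalerN opprK subrK.
Qed.

Lemma root_refl_conj a b v : root_system B a -> root_system B b ->
  root_refl B (root_refl B a b) v = root_refl B a (root_refl B b (root_refl B a v)).
Proof.
move=> /root_systemP[w [i ->]] /root_systemP[w' [j ->]].
rewrite (root_refl_act w i) -act_cat !root_refl_act -!act_cat; congr act.
by rewrite !(rev_cat, rev_cons, revK) -!cats1 -!catA /= -?catA.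
Qed.

Lemma root_neq0 b : root_system B b -> b <> 0.
Proof.
move=> rb b0; have := cartan_diag rb; rewrite /cartan {1}b0 => {b0 rb}.
have := pairing_scalarl (coroot B b) 1 0 0; rewrite scaler0 addr0 mul1r => ? ?; lra.
Qed.

Lemma positive_rootsN b : positive_roots B b -> ~ pos_cone (simple_roots B) (- b).
Proof.
move=> [rb posb] posNb; apply: (root_neq0 rb).
exact: (pos_indep_salient (cr_simple hB)).
Qed.

End BasedRootDatum.

(** * Canonical simple systems *)

Lemma gen_group_is_transf (T : Type) (S : set (T -> T)) : is_transf_group (gen_group S).
Proof.
split; first by move=> G [[]].
  by move=> f g Gf Gg G /[dup] GS [[_ h _] _]; apply: h; [exact: Gf|exact: Gg].
by move=> f g Gf fg gf G /[dup] GS [[_ _ h] _]; apply: h fg gf; exact: Gf.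
Qed.

Lemma gen_group_sub (T : Type) (S S' : set (T -> T)) :
  S `<=` gen_group S' -> gen_group S `<=` gen_group S'.
Proof. by move=> SS'; apply: smallest_sub => //; exact: gen_group_is_transf. Qed.

Section Canonical.
Variables (R : realType) (V V' : lmodType R) (B : rootdata V V').
Hypothesis hB : crystallographic B.

Local Notation pos := (positive_roots B).

(** The orbit of G under the group generated by its own reflections, in a form that gives induction
    over the roots of a subsystem. *)
Inductive refl_orbit (G : set V) : V -> Prop :=
| orbit_base g : G g -> refl_orbit G g
| orbit_refl g b : G g -> refl_orbit G b -> refl_orbit G (root_refl B g b).

Lemma orbit_sub (G G' : set V) b : G `<=` G' -> refl_orbit G b -> refl_orbit G' b.
Proof.
move=> GG'; elim=> [g /GG' Gg|g {}b /GG' Gg _ IH]; first exact: orbit_base.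
exact: orbit_refl.
Qed.

Lemma orbit_subsystem (G Psi : set V) b : root_subsystem B Psi -> G `<=` Psi ->
  refl_orbit G b -> Psi b.
Proof.
by move=> [_ closedP] GP; elim=> [g /GP //|g {}b /GP Pg _ Pb]; exact: closedP.
Qed.

Lemma orbitN (G : set V) b : G `<=` root_system B -> refl_orbit G b -> refl_orbit G (- b).
Proof.
move=> Groot; elim=> [g Gg|g {}b Gg _ IH].
  rewrite -(root_refl_self hB (Groot _ Gg)).
  by apply: orbit_refl => //; exact: orbit_base.
by rewrite -root_reflN //; exact: orbit_refl.
Qed.

Lemma subsystemN (Psi : set V) b : root_subsystem B Psi -> Psi b -> Psi (- b).
Proof.
by move=> [Proot closedP] Pb; rewrite -(root_refl_self hB (Proot _ Pb)); exact: closedP.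
Qed.

(* Dyer's characterisation of the canonical simple system. *)
Definition dyer_simple (Psi : set V) : set V :=
  [set g | [/\ Psi g, pos g &
    forall b, Psi b -> pos b -> b <> g -> pos (root_refl B g b)]].

(** The simple reflection s_a makes no positive root other than a negative. As a lies neither in Psi
    nor in s_a Psi, s_a matches the positive roots of the two subsystems, and with them the two sets
    of Dyer. *)
Lemma dyer_simple_conj (Psi : set V) a g : root_subsystem B Psi ->
  simple_roots B a -> ~ Psi a ->
  dyer_simple [set b | Psi (root_refl B a b)] g -> dyer_simple Psi (root_refl B a g).
Proof.
move=> PS Sa NPa [/= Pg posg refl_g]; have ra := root_simple hB Sa.
have NPa' : ~ Psi (root_refl B a a).
  by rewrite root_refl_self // => /(subsystemN PS); rewrite opprK.
have neq_ga : g <> a by move=> e; apply: NPa'; rewrite -{2}e.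
split=> // [|b Pb posb neq_b]; first exact: simple_refl_pos.
have rg : root_system B g by case: posg.
have rb : root_system B b by case: posb.
rewrite root_refl_conj //.
have neq_ba : b <> a by move=> e; apply: NPa; rewrite -e.
have Pb' : Psi (root_refl B a (root_refl B a b)) by rewrite root_reflK.
apply: simple_refl_pos => //.
  apply: refl_g => //=; first exact: simple_refl_pos.
  by move=> e; apply: neq_b; rewrite -e root_reflK.
move=> e; apply: NPa'; rewrite -{2}e -root_refl_conj //.
by have [_] := PS; apply.
Qed.

Lemma subsystem_conj (Psi : set V) a : root_subsystem B Psi -> simple_roots B a ->
  root_subsystem B [set b | Psi (root_refl B a b)].
Proof.
move=> [Proot closedP] Sa; have ra := root_simple hB Sa.
have rP b : Psi (root_refl B a b) -> root_system B b.
  by move=> /Proot rb; rewrite -[b](root_reflK hB ra); exact: root_root_refl.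
split=> // b b' /= Pb Pb'.
have -> : root_refl B a (root_refl B b b') =
  root_refl B (root_refl B a b) (root_refl B a b').
  by rewrite root_refl_conj ?root_reflK //; exact: rP.
exact: closedP.
Qed.

Lemma simple_dyer_simple (Psi : set V) a : simple_roots B a -> Psi a ->
  dyer_simple Psi a.
Proof.
move=> Sa Pa; split=> //; last by move=> b _; exact: simple_refl_pos.
split; first exact: root_simple.
by rewrite -[a]scale1r; exact: pos_cone_gen.
Qed.

(* Induction on a word carrying a simple root to [b]; a simple reflection that
   is not in [Psi] moves [Psi] together with its canonical simple system. *)
Lemma orbit_dyer_simple (Psi : set V) b : root_subsystem B Psi -> Psi b -> pos b ->
  refl_orbit (dyer_simple Psi) b.
Proof.
move=> PS Pb posb; have [w [i eb]] := (root_systemP hB b).1 posb.1.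
elim: w Psi b eb PS Pb posb => [|j w IH] Psi b eb PS Pb posb.
  by apply/orbit_base/simple_dyer_simple => //; rewrite eb; exact: set_valP.
have Sj := set_valP j.
have [ebj|neq_bj] := pselect (b = val j).
  by apply/orbit_base/simple_dyer_simple => //; rewrite ebj.
have rj := root_simple hB Sj.
rewrite /= in eb; set b' := act _ w _ in eb.
have {}eb : b = root_refl B (val j) b' by rewrite (root_refl_act hB [::]).
have eb' : b' = root_refl B (val j) b by rewrite eb root_reflK.
have posb' : pos b' by rewrite eb'; exact: simple_refl_pos.
have [Pj|NPj] := pselect (Psi (val j)).
  rewrite eb; apply: orbit_refl; first exact: simple_dyer_simple.
  by apply: IH => //; rewrite eb'; have [_] := PS; apply.
have := IH _ b' erefl (subsystem_conj PS Sj) _ posb'; rewrite /= -eb => /(_ Pb).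
rewrite eb; elim=> [g /dyer_simple_conj h|g c Gg _ IHc].
  by apply: orbit_base; exact: h.
have -> : root_refl B (val j) (root_refl B g c) =
  root_refl B (root_refl B (val j) g) (root_refl B (val j) c).
  by rewrite root_refl_conj ?root_reflK //; case: Gg => _ [].
by apply: orbit_refl => //; exact: dyer_simple_conj.
Qed.

(** Suppose x = <g, h^vee> > 0. Then q = s_h(g) = g - x h and s_g(h) are positive, and so is s_g(q).
    But s_g(q) = - g - x s_g(h) is the opposite of an element of the cone. *)
Lemma dyer_simple_cartan (Psi : set V) g h : root_subsystem B Psi ->
  dyer_simple Psi g -> dyer_simple Psi h -> g <> h -> cartan B g h <= 0.
Proof.
move=> [Proot closedP] [Pg posg refl_g] [Ph posh refl_h] neq_gh; rewrite leNgt; apply/negP => x0.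
have posq := refl_h g Pg posg neq_gh; have Pq := closedP _ _ Ph Pg.
have eq : root_refl B h g = g - cartan B g h *: h by [].
have neq_qg : root_refl B h g <> g.
  rewrite eq => /eqP; rewrite subr_eq addrC -subr_eq subrr eq_sym scaler_eq0 gt_eqF //=.
  by move/eqP; exact/root_neq0/Proot.
have posgh := refl_g h Ph posh (fun e => neq_gh (esym e)).
have := refl_g _ Pq posq neq_qg => /(positive_rootsN hB); apply.
rewrite eq -scaleNr (root_reflD hB) (root_reflZ hB) (root_refl_self hB (Proot _ Pg)) scaleNr.
rewrite opprD !opprK; apply: pos_coneD; first by case: posg.
by apply: pos_coneZ; [exact: ltW|case: posgh].
Qed.

Lemma orbit_refl_group (G : set V) b : G `<=` root_system B -> refl_orbit G b ->
  root_system B b /\ refl_group B G (root_refl B b).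
Proof.
move=> Groot; have [_ comp _] := gen_group_is_transf [set root_refl B a | a in G].
have base g : G g -> refl_group B G (root_refl B g).
  by move=> Gg; apply: sub_gen_smallest; exists g.
elim=> [g Gg|g {}b Gg _ [rb IH]]; first by split; [exact: Groot|exact: base].
split; first by apply: root_root_refl => //; exact: Groot.
have -> : root_refl B (root_refl B g b) = root_refl B g \o (root_refl B b \o root_refl B g).
  by apply/funext => v /=; rewrite root_refl_conj //; exact: Groot.
exact: (comp _ _ (base _ Gg) (comp _ _ IH (base _ Gg))).
Qed.

(** Positive roots of Psi lie in the orbit of Dyer's set, so their reflections lie in its group. A
    negative root has the same reflection as its opposite. *)
Lemma dyer_simple_canonical (Psi : set V) : root_subsystem B Psi ->
  is_canonical_simple B Psi (dyer_simple Psi).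
Proof.
move=> PS; have [Proot closedP] := PS.
have GP : dyer_simple Psi `<=` Psi by move=> g [].
split=> //; first by move=> g [].
  apply/seteqP; split; apply: gen_group_sub => _ [b Pb <-].
    by apply: sub_gen_smallest; exists b => //; exact: GP.
  have Groot := subset_trans GP Proot.
  have [posb|posNb] := root_sign hB (Proot _ Pb).
    by have [] := orbit_refl_group Groot (orbit_dyer_simple PS Pb (conj (Proot _ Pb) posb)).
  have PNb := subsystemN PS Pb.
  have [_] := orbit_refl_group Groot (orbit_dyer_simple PS PNb (conj (Proot _ PNb) posNb)).
  congr (refl_group B _ _); apply/funext => v.
  rewrite -(root_refl_self hB (Proot _ Pb)) root_refl_conj //; try exact: Proot.
  by rewrite root_reflK //; exact: Proot.
by move=> g h Gg Gh neq_gh; exact: (dyer_simple_cartan PS Gg Gh neq_gh).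
Qed.

Lemma canonical_simpleP (Psi : set V) : root_subsystem B Psi ->
  is_canonical_simple B Psi (canonical_simple B Psi).
Proof.
move=> PS; apply: (xgetPex set0 (P := [set G | is_canonical_simple B Psi G])).
by exists (dyer_simple Psi); exact: dyer_simple_canonical.
Qed.

End Canonical.

(** * The lifted root system *)

Section Lift.
Variables (R : realType) (V V' : lmodType R) (B : rootdata V V').
Hypothesis hB : crystallographic B.
Variable Psi : set V.
Hypothesis PS : root_subsystem B Psi.

Local Notation G := (canonical_simple B Psi).

Let GP : G `<=` Psi. Proof. by have [] := canonical_simpleP hB PS. Qed.

Let Groot : G `<=` root_system B. Proof. exact: subset_trans GP PS.1. Qed.

Lemma canonical_root (i : G) : root_system B (val i).
Proof. exact/Groot/set_valP. Qed.

Definition canonical_cartan (i j : G) : R := cartan B (val i) (val j).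

Lemma canonical_gcm : gcm canonical_cartan.
Proof.
have [_ _ _ nonpos] := canonical_simpleP hB PS.
split=> [i|i j|i j /eqP neq_ij|i j].
- exact/(cartan_diag hB)/canonical_root.
- by apply: (cartan_int hB); exact: canonical_root.
- apply: nonpos; [exact: set_valP|exact: set_valP|].
  by move=> /val_inj.
- by apply: (cartan_eq0 hB); exact: canonical_root.
Qed.

Definition canonical_real : realization canonical_cartan V :=
  @Realization _ _ canonical_cartan _ val
    (fun i v => root_pairing B v (coroot B (val i)))
    (fun i => pairing_scalarl hB (coroot B (val i)))
    (fun i j => erefl).

Lemma canonical_pos_cone (i : G) : pos_cone (simple_roots B) (rvec canonical_real i).
Proof. by have [_ /(_ _ (set_valP i))[]] := canonical_simpleP hB PS. Qed.

Lemma canonical_salient : salient (rvec canonical_real).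
Proof.
move=> v /(cone_pos_cone canonical_pos_cone) cv /(cone_pos_cone canonical_pos_cone).
exact: (pos_indep_salient (cr_simple hB)).
Qed.

Lemma canonical_refl_group : refl_group B G = [set act canonical_real w | w in setT].
Proof.
apply: gen_group_words; first exact: canonical_gcm.
apply/seteqP; split=> [_ [a Ga <-]|_ [i _ <-]]; last by exists (val i) => //; exact: set_valP.
by exists (SigSub (mem_set Ga)).
Qed.

Lemma orbitP b : refl_orbit B G b <-> exists w (i : G), b = act canonical_real w (val i).
Proof.
split=> [|[w [i ->]]].
  elim=> [g Gg|g {}b Gg _ [w [i ->]]]; first by exists [::], (SigSub (mem_set Gg)).
  by exists (SigSub (mem_set Gg) :: w), i.
elim: w => [|j w IH]; first exact/orbit_base/set_valP.
exact: (orbit_refl (set_valP j) IH).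
Qed.

(* The reflection in a root [a] of [dyer_simple Psi] lies in the group generated
   by [G], so it makes some element of [G] negative; this can only be [a]. *)
Lemma dyer_simple_sub : dyer_simple B Psi `<=` G.
Proof.
move=> a [Pa posa refl_a]; have ra := PS.1 _ Pa.
have [_ Gpos eqW _] := canonical_simpleP hB PS.
have [w _ ew] : [set act canonical_real w | w in setT] (root_refl B a).
  by rewrite -canonical_refl_group eqW; apply: sub_gen_smallest; exists a.
(* If all canonical simple roots stayed positive, the word would be trivial and s_a would fix a,
   whereas s_a(a) = -a. *)
have [i ncone] : exists i,
    ~ cone (rvec canonical_real) (act canonical_real w (rvec canonical_real i)).
  apply/existsNP => cones.
  have := act_ceq canonical_real canonical_gcm a
    (ceq_nil_cone canonical_gcm canonical_salient cones).
  rewrite ew root_refl_self //= => /eqP; rewrite eq_sym -addr_eq0 -mulr2n -scaler_nat.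
  by rewrite scaler_eq0 pnatr_eq0 => /eqP; exact: (root_neq0 hB).
have [//|cN] := act_vec_sign canonical_real canonical_gcm w i.
have Gi := set_valP i.
have [<- //|neq_ia] := pselect (val i = a).
have := refl_a (val i) (GP Gi) (Gpos _ Gi) neq_ia => /(positive_rootsN hB) [].
by rewrite -ew; exact: (cone_pos_cone canonical_pos_cone).
Qed.

Lemma subsystem_orbit b : Psi b <-> refl_orbit B G b.
Proof.
split; last exact: (orbit_subsystem PS GP).
move=> Pb; have rb := PS.1 _ Pb.
have pos_orbit c : Psi c -> positive_roots B c -> refl_orbit B G c.
  by move=> Pc posc; apply: orbit_sub dyer_simple_sub _; exact: orbit_dyer_simple.
have [posb|posNb] := root_sign hB rb; first exact: pos_orbit.
rewrite -[b]opprK; apply: (orbitN hB) => //.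
have PNb := subsystemN hB PS Pb; apply: pos_orbit => //.
by split=> //; exact: PS.1.
Qed.

Lemma subsystem_act b : Psi b -> exists w (i : G), b = act canonical_real w (val i).
Proof. by move=> /subsystem_orbit/orbitP. Qed.

Lemma canonical_act_root w (i : G) : root_system B (act canonical_real w (val i)).
Proof. by apply/PS.1/subsystem_orbit/orbitP; exists w, i. Qed.

Lemma root_refl_canonical_act w (i : G) v :
  root_refl B (act canonical_real w (val i)) v = act canonical_real (w ++ i :: rev w) v.
Proof.
elim: w v => [//|j w IH] v /=.
have -> : srefl canonical_real j (act canonical_real w (val i)) =
  root_refl B (val j) (act canonical_real w (val i)) by [].
rewrite root_refl_conj //; last 2 first.
- exact: canonical_root.
- exact: canonical_act_root.
by rewrite IH rev_cons -cats1 -cat_cons catA [in RHS]act_cat.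
Qed.

Local Notation free := (free_real canonical_cartan).

Lemma lift_root_systemP x : lift_root_system (B := B) (Psi := Psi) x <->
  exists w i, x = act free w << i >>.
Proof.
have weylE : weyl (lift_data B Psi) = [set act free w | w in setT].
  apply: gen_group_words; first exact: canonical_gcm.
  have eq i : reflection (lift_data B Psi) << i >> << i >> = srefl free i.
    apply/funext => v; congr (_ - _ *: _) => /=.
    apply: (congr1 (fun f : G -> R^o => fglift f v)); apply/funext => a.
    by rewrite liftU scale1r.
  apply/seteqP; split=> [_ [_ [i _ <-] <-]|_ [i _ <-]]; first by exists i => //; rewrite -eq.
  by exists << i >>; [exists i|exact: eq].
rewrite /lift_root_system /root_system weylE; split=> [[_ [w _ <-] [_ [i _ <-] <-]]|].
  by exists w, i.
by move=> [w [i ->]]; exists (act free w); [exists w|exists << i >> => //; exists i].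
Qed.

Lemma lift_map_act w i : lift_map (act free w << i >>) = act canonical_real w (val i).
Proof.
elim: w => [|j w IH] /=; first by rewrite /lift_map liftU scale1r.
rewrite /srefl /lift_map lift_is_additive fglift_scalable -/(lift_map _) IH liftU scale1r.
by rewrite (rform_act_eq canonical_real free).
Qed.

(** The linear map L need not be injective on [V_0], since canonical simple roots may be dependent.
    On roots, however, an equality in [V] transfers to the free realization. *)
Lemma lift_map_inj x y : lift_root_system (B := B) (Psi := Psi) x ->
  lift_root_system (B := B) (Psi := Psi) y -> lift_map x = lift_map y -> x = y.
Proof.
move=> /lift_root_systemP[w [i ->]] /lift_root_systemP[w' [j ->]]; rewrite !lift_map_act => e.
have := act_transfer canonical_gcm canonical_salient free (w := rev w' ++ w)
  (i := i) (j := j) (x := 1).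
rewrite !act_cat !scale1r /= e act_revK; last exact: canonical_gcm.
by move=> /(_ erefl) /= <-; rewrite act_Krev //; exact: canonical_gcm.
Qed.

Lemma lift_rootP (a : Psi) :
  lift_root_system (val (lift_root B a)) /\ lift_map (val (lift_root B a)) = val a.
Proof.
apply: (xgetPex 0 (P := [set x : root_lattice B Psi |
  lift_root_system (val x) /\ lift_map (val x) = val a])).
have [w [i e]] := subsystem_act (set_valP a).
have rx : lift_root_system (B := B) (Psi := Psi) (act free w << i >>).
  by apply/lift_root_systemP; exists w, i.
have zx : act free w << i >> \in zspan_pred (@lift_root_system R V V' B Psi).
  by apply: mem_set; exact: sub_gen_smallest.
by exists (ZSpan zx); rewrite /= lift_map_act e.
Qed.

Lemma lift_root_unique (a : Psi) x : lift_root_system (B := B) (Psi := Psi) x ->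
  lift_map x = val a -> val (lift_root B a) = x.
Proof.
by move=> rx ex; have [ra ea] := lift_rootP a; apply: lift_map_inj; rewrite // ea ex.
Qed.

Lemma lift_root_canonical (a : Psi) (i : G) : val a = val i ->
  val (lift_root B a) = << i >>.
Proof.
move=> e; apply: lift_root_unique; first by apply/lift_root_systemP; exists [::], i.
by rewrite e; exact: (lift_map_act [::] i).
Qed.

Lemma lift_root_refl (a b d : Psi) : val d = root_refl B (val a) (val b) ->
  val (lift_root B d) =
  val (lift_root B b) - cartan B (val b) (val a) *: val (lift_root B a).
Proof.
move=> ed; have [/lift_root_systemP[w [i ea]] La] := lift_rootP a.
have [/lift_root_systemP[w' [j eb]] Lb] := lift_rootP b.
rewrite ea lift_map_act in La; rewrite eb lift_map_act in Lb.
have ed' : val d = act canonical_real ((w ++ i :: rev w) ++ w') (val j).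
  by rewrite ed -La -Lb root_refl_canonical_act [RHS]act_cat.
rewrite (@lift_root_unique d (act free ((w ++ i :: rev w) ++ w') << j >>)); last 2 first.
- by apply/lift_root_systemP; exists ((w ++ i :: rev w) ++ w'), j.
- by rewrite lift_map_act.
rewrite act_cat act_refl; last exact: canonical_gcm.
rewrite -ea -eb; congr (_ - _ *: _); rewrite eb -act_cat.
(* The coefficient in [V_0] is a pairing, so it can be computed in [V]. There two expressions for d
   are compared, and a is not 0. *)
rewrite (rform_act_eq canonical_real free) /=.
have := ed; rewrite ed' act_cat act_refl; last exact: canonical_gcm.
rewrite Lb La /root_refl /reflection -/(cartan B (val b) (val a)) act_cat => /addrI/oppr_inj/eqP.
rewrite -subr_eq0 -scalerBl scaler_eq0 subr_eq0 => /orP[/eqP <-|/eqP a0].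
  by rewrite Lb.
by have := root_neq0 hB (PS.1 _ (set_valP a)).
Qed.

End Lift.

(** * Coweights and root functions *)

Lemma multiples0 n : multiples n 0.
Proof. exact: dvdz0. Qed.

Lemma multiplesB n x y : multiples n x -> multiples n y -> multiples n (x - y).
Proof. exact: rpredB. Qed.

(* The smallest positive element of [S] generates [S]: reduce modulo its double. *)
Lemma int_set_multiples (S : set int) : S 0 ->
  (forall x y, S x -> S y -> S (x - 2 * y)) -> exists n, S = multiples n.
Proof.
move=> S0 SB.
have SN x : S x -> S (- x) by move=> Sx; rewrite (_ : - x = x - 2 * x); [exact: SB|ring].
have S2M x y (k : int) : S x -> S y -> S (x + k * (2 * y)).
  move=> Sx Sy.
  have nonneg (m : nat) z : S z -> S (x + m%:Z * (2 * z)).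
    move=> Sz; elim: m => [|m IH]; first by rewrite mul0r addr0.
    have -> : x + m.+1%:Z * (2 * z) = x + m%:Z * (2 * z) - 2 * (- z).
      by rewrite -natr1; ring.
    by apply: SB => //; exact: SN.
  case: k => m; first exact: nonneg.
  by rewrite NegzE mulNr -mulrN -mulrN; apply: nonneg; exact: SN.
have [posS|nposS] := pselect (exists n : nat, (0 < n)%N /\ S n%:Z); last first.
  exists 0%N; apply/seteqP; split=> x /=; last by rewrite /multiples /= dvd0z => /eqP ->.
  move=> Sx; rewrite /multiples /= dvd0z; apply: contra_notT nposS => x0.
  exists `|x|%N; rewrite absz_gt0; split=> //.
  by rewrite abszE; case: (ger0P x) => // _; exact: SN.
have exn : exists n, `[< (0 < n)%N /\ S n%:Z >] by have [n h] := posS; exists n; apply/asboolP.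
have [n /asboolP[n0 Sn] min_n] := ex_minnP exn.
exists n; apply/seteqP; split=> x; last first.
  move=> /dvdzP[k ->].
  have [j [->|->]] : exists j : int, k = j * 2 \/ k = 1 + j * 2.
    exists (k %/ 2)%Z; have := divz_eq k 2; have := modz_ge0 k (isT : 2 != 0 :> int).
    have := ltz_pmod k (isT : 0 < 2 :> int); lia.
  - by have := S2M 0 _ j S0 Sn; rewrite add0r -mulrA.
  - by have := S2M _ _ j Sn Sn; rewrite [(1 + _) * _]mulrDl mul1r -mulrA.
move=> Sx; rewrite /multiples /=.
pose r := (x %% (2 * n%:Z))%Z.
have r0 : 0 <= r by apply: modz_ge0; lia.
have rlt : r < 2 * n%:Z by apply: ltz_pmod; lia.
have er : x = r + (x %/ (2 * n%:Z))%Z * (2 * n%:Z) by rewrite addrC; exact: divz_eq.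
have Sr : S r.
  have := S2M x _ (- (x %/ (2 * n%:Z))%Z) Sx Sn.
  by rewrite {1}er mulNr addrK.
have min_pos (y : int) : 0 < y -> S y -> n%:Z <= y.
  move=> y0 Sy; have ey : y = `|y|%N%:Z by lia.
  rewrite ey lez_nat; apply: min_n; apply/asboolP; rewrite -ey; split=> //; lia.
(* A remainder r > n would put the smaller positive number 2 n - r into S. *)
have r_cases : r = 0 \/ r = n%:Z.
  have [->|rn0] := eqVneq r 0; first by left.
  right; have rn : n%:Z <= r by apply: min_pos => //; lia.
  have [//|neq] := eqVneq r n%:Z.
  have Sr' : S (2 * n%:Z - r).
    by have := S2M _ _ 1 (SN _ Sr) Sn; rewrite mul1r addrC.
  by have := min_pos _ _ Sr'; lia.
by rewrite er; case: r_cases => ->; rewrite ?add0r mulrA ?dvdz_mull // rpredD // dvdz_mull.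
Qed.

Section Coweights.
Variables (R : realType) (V V' : lmodType R) (B : rootdata V V').
Hypothesis hB : crystallographic B.
Variable Psi : set V.
Hypothesis PS : root_subsystem B Psi.

Local Notation G := (canonical_simple B Psi).
Local Notation free := (free_real (@canonical_cartan R V V' B Psi)).
Local Notation coweights := (@coweights R V V' B Psi).

Definition subsystem_root b (Pb : Psi b) : Psi := SigSub (mem_set Pb).

Lemma cartan_intP a b : root_system B a -> root_system B b ->
  exists c : int, cartan B a b = c%:~R.
Proof. by move=> ra rb; apply/intrP/(cartan_int hB). Qed.

Lemma refl_compatibleP (D : set V) (Z : D -> set int) a b d (c x y : int) :
  refl_compatible B Z -> val d = root_refl B (val a) (val b) ->
  cartan B (val b) (val a) = c%:~R -> Z b x -> Z a y -> Z d (x - c * y).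
Proof.
move=> compat ed ec Zx Zy; have [|z Zz] := compat a b d ed (x%:~R - cartan B (val b) (val a) * y%:~R).
  by exists x => //; exists y.
by rewrite ec -intrM -intrB => /intr_inj <-.
Qed.

Lemma coweight_refl f (a b d : Psi) (c : int) : coweights f ->
  val d = root_refl B (val a) (val b) -> cartan B (val b) (val a) = c%:~R ->
  f (lift_root B d) = f (lift_root B b) - c * f (lift_root B a).
Proof.
move=> cf ed ec.
pose f' : {additive root_lattice B Psi -> int} :=
  HB.pack f (GRing.isZmodMorphism.Build _ _ f cf).
have -> : lift_root B d = lift_root B b - lift_root B a *~ c.
  apply: val_inj; rewrite (lift_root_refl hB PS ed) ec scaler_int.
  by rewrite raddfB; congr (_ - _); exact/esym/raddfMz.
have -> : f = f' by [].
by rewrite raddfB raddfMz mulrzz mulrC.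
Qed.

(** Coweights take values in [int], functions on [V_0] in the reals. [F] is integral on the root
    lattice, so [Num.floor] is exact there. *)
Lemma floor_coweight (F : lift_space B Psi -> R) :
  (forall u v, F (u - v) = F u - F v) ->
  (forall w i, F (act free w << i >>) \is a Num.int) ->
  coweights (fun x => Num.floor (F (val x))) /\
  forall x : root_lattice B Psi, (Num.floor (F (val x)))%:~R = F (val x).
Proof.
move=> FB Fint.
have FE (x : root_lattice B Psi) : (Num.floor (F (val x)))%:~R = F (val x).
  apply: floorK; have /set_mem := valP x.
  apply: (@smallest_sub _ _ _ [set v | F v \is a Num.int]).
    split=> [|u v /= Fu Fv]; last by rewrite FB rpredB.
    by have := FB 0 0; rewrite /= subrr => ->; rewrite subrr rpred0.
  by move=> v /(lift_root_systemP hB PS)[w [i ->]]; exact: Fint.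
split=> // x y; apply: (@intr_inj R).
by rewrite intrB !FE /= -FB.
Qed.

Lemma ex_coweight (z : V -> int) : exists2 f, coweights f &
  forall a : Psi, G (val a) -> f (lift_root B a) = z (val a).
Proof.
pose zR (i : G) : R^o := (z (val i))%:~R.
pose F (v : lift_space B Psi) : R := fglift zR v.
have FB u v : F (u - v) = F u - F v by exact: (lift_is_additive zR).
have FZ x v : F (x *: v) = x * F v by exact: (fglift_scalable zR).
have FU i : F << i >> = (z (val i))%:~R by rewrite /F liftU scale1r.
have [|cf FE] := @floor_coweight F FB.
  elim=> [|j w IH] i /=; first by rewrite FU rpred_int.
  rewrite /srefl FB FZ FU rpredB // rpredM ?rpred_int //.
  exact: (rform_act_int free (canonical_gcm hB PS)).
exists (fun x => Num.floor (F (val x))) => // a Ga; apply: (@intr_inj R).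
by rewrite FE (lift_root_canonical hB PS (i := SigSub (mem_set Ga))) // FU.
Qed.

Lemma coweight_compatible (Z : Psi -> set int) f : refl_compatible B Z ->
  coweights f -> (forall a : Psi, G (val a) -> Z a (f (lift_root B a))) ->
  forall a : Psi, Z a (f (lift_root B a)).
Proof.
move=> compat cf Zf a.
have GP : G `<=` Psi by have [] := canonical_simpleP hB PS.
have : refl_orbit B G (val a) by apply/(subsystem_orbit hB PS)/set_valP.
have [v ev] : exists v, val a = v by exists (val a).
rewrite ev => ov.
elim: ov a ev => [g Gg|g b Gg ob IH] a ev; first by apply: Zf; rewrite ev.
have Pb := orbit_subsystem PS GP ob.
have [c ec] := cartan_intP (PS.1 _ Pb) (PS.1 _ (GP _ Gg)).
pose a' := subsystem_root (GP _ Gg); pose b' := subsystem_root Pb.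
rewrite (@coweight_refl f a' b' a c) //; apply: (@refl_compatibleP _ Z a' b' a c) => //.
  exact: IH.
exact: (Zf a').
Qed.

Lemma rform_lift_root (a : Psi) (i : G) :
  rform free i (val (lift_root B a)) = cartan B (val a) (val i).
Proof.
have [/(lift_root_systemP hB PS)[w [j ea]] La] := lift_rootP hB PS a.
rewrite ea (lift_map_act hB) in La.
by rewrite ea (rform_act_eq (canonical_real hB Psi) free) -La.
Qed.

(** The coweight [f'] is f composed with the reflection in g_0. Writing it as f - <-, g^vee> f(g_0)
    avoids constructing that reflection as a map of the lattice. *)
Lemma coweight_comp_refl f g : coweights f -> G g ->
  exists2 f', coweights f' & forall a d : Psi, val d = root_refl B g (val a) ->
    f' (lift_root B a) = f (lift_root B d).
Proof.
move=> cf Gg; pose i : G := SigSub (mem_set Gg).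
have GP : G `<=` Psi by have [] := canonical_simpleP hB PS.
pose a0 := subsystem_root (GP _ Gg).
have [||cphi phiE] := @floor_coweight (rform free i).
- exact: rformB.
- by move=> w j; exact: (rform_act_int free (canonical_gcm hB PS)).
exists (fun x => f x - Num.floor (rform free i (val x)) * f (lift_root B a0)).
  by move=> x y; rewrite cf cphi; ring.
move=> a d ed; have [c ec] := cartan_intP (PS.1 _ (set_valP a)) (PS.1 _ (GP _ Gg)).
rewrite (@coweight_refl f a0 a d c) //; congr (_ - _ * _).
by apply: (@intr_inj R); rewrite phiE rform_lift_root.
Qed.

(** For a canonical simple root, the coweight with value z there and 0 at the other basis elements
    is admissible by [coweight_compatible]. Other roots are reached by composing with reflections:
    compatibility with y = 0 shows that reflections do not shrink the sets n_b Z, so the conditions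
    are preserved. *)
Lemma multiples_values (n : Psi -> nat) (a : Psi) z :
  refl_compatible B (fun a => multiples (n a)) -> multiples (n a) z ->
  exists f, [/\ coweights f, (forall b, multiples (n b) (f (lift_root B b))) &
    f (lift_root B a) = z].
Proof.
move=> compat; have GP : G `<=` Psi by have [] := canonical_simpleP hB PS.
have refl_n (g b d : Psi) y : val d = root_refl B (val g) (val b) ->
    multiples (n b) y -> multiples (n d) y.
  move=> ed ny; have [c ec] := cartan_intP (PS.1 _ (set_valP b)) (PS.1 _ (set_valP g)).
  have := refl_compatibleP compat ed ec ny (multiples0 _).
  by rewrite mulr0 subr0.
have : refl_orbit B G (val a) by apply/(subsystem_orbit hB PS)/set_valP.
have [v ev] : exists v, val a = v by exists (val a).
rewrite ev => ov.
elim: ov a z ev => [g Gg|g b Gg ob IH] a z ev nz.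
  have [f cf fE] := ex_coweight (fun v => if v == g then z else 0).
  exists f; split=> //; last by rewrite fE ev ?eqxx.
  apply: (coweight_compatible (Z := fun a => multiples (n a))) => // b Gb.
  rewrite fE //; case: eqP => [eb|_]; last exact: multiples0.
  by have -> : b = a by apply: val_inj; rewrite eb ev.
have Pb := orbit_subsystem PS GP ob.
pose g' := subsystem_root (GP _ Gg); pose b' := subsystem_root Pb.
have rg : root_system B g := PS.1 _ (GP _ Gg).
have eb : val b' = root_refl B (val g') (val a) by rewrite ev root_reflK.
have [f [cf nf fb]] := IH b' z erefl (refl_n _ _ _ _ eb nz).
have [f' cf' f'E] := coweight_comp_refl cf Gg.
exists f'; split=> //; last by rewrite (f'E a b').
move=> d; have Pd := PS.2 _ _ (GP _ Gg) (set_valP d).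
rewrite (f'E d (subsystem_root Pd)) //; apply: (refl_n g' (subsystem_root Pd)) => //=.
by rewrite root_reflK.
Qed.

Lemma coweightsD f g : coweights f -> coweights g -> coweights (f + g).
Proof. by move=> cf cg x y; rewrite !addrfctE cf cg opprD addrACA. Qed.

Lemma coweightsB f g : coweights f -> coweights g -> coweights (f - g).
Proof.
move=> cf cg x y; rewrite !addrfctE !opprfctE cf cg; ring.
Qed.

(** The normal form of a coset, by a representative f and a function n. It serves both to check the
    attached function and to recover Y from it. *)
Lemma coset_values Y : (exists X, admissible (B := B) X /\ is_coset X Y) ->
  exists f (n : Psi -> nat), [/\ coweights f,
    refl_compatible B (fun a => multiples (n a)),
    Y = [set h | coweights h /\
          forall a, multiples (n a) (h (lift_root B a) - f (lift_root B a))] &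
    forall a, values Y (lift_root B a) =
      [set z | multiples (n a) (z - f (lift_root B a))]].
Proof.
move=> [X [[Xcow [X0 XB] [n [compat eX]]] [f cf eY]]]; exists f, n.
have eY' : Y = [set h | coweights h /\
    forall a, multiples (n a) (h (lift_root B a) - f (lift_root B a))].
  rewrite eY; apply/seteqP; split=> [_ [g + <-]|h [ch nh]].
    rewrite eX => -[cg ng]; split=> [|a]; first exact: coweightsD.
    by rewrite addrfctE addrC addrK; exact: ng.
  exists (h - f); last by rewrite addrC subrK.
  by rewrite eX; split; [exact: coweightsB|exact: nh].
split=> // a; rewrite eY'; apply/seteqP; split=> [_ [h [_ nh] <-]|z nz]; first exact: nh.
have [g [cg ng eg]] := multiples_values compat nz.
exists (f + g); last by rewrite addrfctE eg addrC subrK.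
split=> [|b]; first exact: coweightsD.
by rewrite addrfctE addrC addrK; exact: ng.
Qed.

End Coweights.

(** * Root functions and their cosets *)

Section RootFunctions.
Variables (R : realType) (V V' : lmodType R) (B : rootdata V V').
Hypothesis hB : crystallographic B.

Local Notation datum := {Psi : set V & set (root_lattice B Psi -> int)}.

Lemma refl_compatibleI (D : set V) (Z : D -> set int) : D `<=` root_system B ->
  (forall (a b d : D) (c x y : int), val d = root_refl B (val a) (val b) ->
    cartan B (val b) (val a) = c%:~R -> Z b x -> Z a y -> Z d (x - c * y)) ->
  refl_compatible B Z.
Proof.
move=> Droot ZD a b d ed _ [x Zx [y Zy <-]].
have [c ec] := cartan_intP hB (Droot _ (set_valP b)) (Droot _ (set_valP a)).
by exists (x - c * y); [exact: (ZD a b)|rewrite ec intrB intrM].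
Qed.

(** The existential over Psi makes the value empty at roots outside Psi. *)
Definition attached_function (p : datum) : root_system B -> set int :=
  fun a => [set z | exists2 b : projT1 p, val a = val b &
    values (projT2 p) (lift_root B b) z].

(** Coweights satisfy the root function condition with equality, so f cancels and the compatibility
    of n remains. The support is all of Psi because f(b_0) is a value at b. *)
Lemma attached_attached_function (p : datum) : subsystem_cosets p ->
  attached p (attached_function p).
Proof.
case: p => Psi Y [/= PS /(coset_values hB PS)[f [n [cf compat _ valY]]]].
split=> /=.
- apply: refl_compatibleI => // a b d c x y ed ec [b' eb Yx] [a' ea Yy].
  have Pd : Psi (val d) by rewrite ed eb ea; apply: PS.2; exact: set_valP.
  exists (subsystem_root Pd) => //=.
  have ed' : val (subsystem_root Pd) = root_refl B (val a') (val b').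
    by rewrite /= ed eb ea.
  rewrite eb ea in ec; rewrite /= in Yx Yy.
  rewrite valY /= (coweight_refl hB PS cf ed' ec); rewrite !valY /= in Yx Yy.
  have := refl_compatibleP compat ed' ec Yx Yy.
  by congr (multiples _ _); ring.
- apply/seteqP; split=> [_ [a [z [b -> _]] <-]|b Pb]; first exact: set_valP.
  exists (SigSub (mem_set (PS.1 _ Pb))) => //=.
  exists (f (lift_root B (subsystem_root Pb))), (subsystem_root Pb) => //=.
  by rewrite valY /= subrr; exact: multiples0.
- move=> a b eab; apply/seteqP; split=> [z [b' eb']|z Yz]; last by exists b.
  by have -> : b' = b by apply: val_inj; exact: etrans (esym eb') eab.
Qed.

Lemma attached_inj (p : datum) Z Z' : attached p Z -> attached p Z' -> Z = Z'.
Proof.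
move=> [_ eP eZ] [_ eP' eZ']; apply/funext => a.
have [Pa|NPa] := pselect (projT1 p (val a)).
  by rewrite (eZ a (subsystem_root Pa)) // (eZ' a (subsystem_root Pa)).
have empty (T : root_system B -> set int) : root_support T = projT1 p -> T a = set0.
  move=> eT; apply/seteqP; split=> // z Tz; apply: NPa; rewrite -eT.
  by exists a => //; exists z.
by rewrite !empty.
Qed.

Lemma attached_cancel (p q : datum) Z : subsystem_cosets p -> subsystem_cosets q ->
  attached p Z -> attached q Z -> p = q.
Proof.
case: p q => [Psi Y] [Psi' Y'] [/= PS hY] [_ /= hY'] [_ /= eP eZ] [_ /= eP' eZ'].
(* The type of [Y'] depends on [Psi'], so the two supports are identified before the cosets can be
   compared. *)
rewrite -{}eP' {}eP in Y' hY' eZ' *; congr existT.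
have Ydef T : (exists X, admissible (B := B) X /\ is_coset X T) ->
    (forall (a : root_system B) (b : Psi), val a = val b ->
      Z a = values T (lift_root B b)) ->
    T = [set h | coweights (B := B) h /\ forall (a : root_system B) (b : Psi),
           val a = val b -> Z a (h (lift_root B b))].
  move=> /(coset_values hB PS)[f [n [cf _ eT valT]]] ZT.
  rewrite {1}eT; apply/seteqP; split=> h [ch nh]; split=> //.
    by move=> a b eab; rewrite (ZT a b eab) valT; exact: nh.
  move=> b; pose b' : root_system B := SigSub (mem_set (PS.1 _ (set_valP b))).
  by have := nh b' b erefl; rewrite (ZT b' b erefl) valT.
by rewrite (Ydef Y) // (Ydef Y').
Qed.

Lemma root_support_subsystem (Z : root_system B -> set int) : root_function Z ->
  root_subsystem B (root_support Z).
Proof.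
move=> compat; split=> [_ [a _ <-]|_ _ [a [y Zy] <-] [b [x Zx] <-]]; first exact: set_valP.
have rd := root_root_refl hB (set_valP a) (set_valP b).
have [c ec] := cartan_intP hB (set_valP b) (set_valP a).
exists (SigSub (mem_set rd)) => //; exists (x - c * y).
exact: (refl_compatibleP compat _ ec).
Qed.

(** Reflecting a in itself gives Z_a - 2 Z_a inside Z_(-a). Reflecting -a in itself, with 0 in
    Z_(-a), gives Z_(-a) inside Z_a. So Z_a is stable under x - 2 y. *)
Lemma root_function0_multiples (Psi : set V) (Z : Psi -> set int) :
  root_subsystem B Psi -> refl_compatible B Z -> (forall a, Z a 0) ->
  forall a, exists n, Z a = multiples n.
Proof.
move=> PS compat Z0 a.
have refl_neg (b d : Psi) x y : val d = - val b -> Z b x -> Z b y -> Z d (x - 2 * y).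
  move=> ed; have rb := PS.1 _ (set_valP b).
  apply: (refl_compatibleP compat); first by rewrite (root_refl_self hB).
  by rewrite (cartan_diag hB).
pose a' := subsystem_root (subsystemN hB PS (set_valP a)).
apply: int_set_multiples => // x y Zx Zy.
have Zx' : Z a' (x - 2 * y) by exact: (refl_neg a).
have := refl_neg a' a _ 0 _ Zx' (Z0 a').
by rewrite mulr0 subr0 /= opprK; apply.
Qed.

Lemma ex_attached (Z : root_system B -> set int) : root_function Z ->
  exists2 p : datum, subsystem_cosets p & attached p Z.
Proof.
move=> compat; pose Psi := root_support Z.
have PS : root_subsystem B Psi := root_support_subsystem compat.
pose rt (a : Psi) : root_system B := SigSub (mem_set (PS.1 _ (set_valP a))).
pose ZP (a : Psi) := Z (rt a).
have compatP : refl_compatible B ZP by move=> a b d ed; exact: (compat (rt a) (rt b) (rt d)).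
(* An element of Z_g is chosen for each g. The default 0 is never met at a canonical simple root,
   since such a root lies in the support. *)
have [f cf fE] := ex_coweight hB PS (fun v =>
  xget 0 [set x | exists2 b : root_system B, val b = v & Z b x]).
have Zf : forall a, ZP a (f (lift_root B a)).
  apply: (coweight_compatible hB PS) => // a Ga; rewrite fE //.
  case: xgetP => [x _ [b eb Zb]|none].
    by rewrite /ZP (_ : rt a = b) //; exact/val_inj/esym.
  have [b [x Zx] eb] := set_valP a.
  by case: (none x); exists b.
have /choice[n nE] : forall a : Psi, exists n,
    [set z | ZP a (f (lift_root B a) + z)] = multiples n.
  apply: root_function0_multiples => //; last by move=> a /=; rewrite addr0.
  apply: refl_compatibleI => [|a b d c x y ed ec /= Zx Zy]; first exact: PS.1.
  rewrite (coweight_refl hB PS cf ed ec).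
  have := refl_compatibleP compatP ed ec Zx Zy.
  by congr (ZP d _); ring.
have nP a z : ZP a z <-> multiples (n a) (z - f (lift_root B a)).
  by rewrite -nE /= addrC subrK.
have compat_n : refl_compatible B (fun a => multiples (n a)).
  apply: refl_compatibleI => [|a b d c x y ed ec nx ny]; first exact: PS.1.
  have Zshift (e : Psi) z : multiples (n e) z -> ZP e (f (lift_root B e) + z).
    by move=> nz; apply/nP; rewrite addrC addKr.
  have := refl_compatibleP compatP ed ec (Zshift _ _ nx) (Zshift _ _ ny).
  by move/nP; rewrite (coweight_refl hB PS cf ed ec); congr (multiples _ _); ring.
pose X := [set g | coweights (B := B) (Psi := Psi) g /\
  forall a, multiples (n a) (g (lift_root B a))].
exists (existT _ Psi [set f + g | g in X]).
  split=> //=; exists X; split; last by exists f.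
  split; first by move=> g [].
    split; first by split=> [x y|a]; [rewrite subrr|exact: multiples0].
    move=> g h [cg ng] [ch nh]; split; first exact: coweightsB.
    by move=> a; exact: multiplesB.
  by exists n.
split=> //= a b eab; have -> : a = rt b by exact: val_inj.
apply/seteqP; split=> [z /nP nz|_ [_ [g [cg ng] <-] <-]].
  have [g [cg ng eg]] := multiples_values hB PS compat_n nz.
  by exists (f + g); [exists g|rewrite addrfctE eg addrC subrK].
by apply/nP; rewrite addrfctE addrC addrK.
Qed.

End RootFunctions.

Theorem theorem24 (R : realType) (V V' : lmodType R) (B : rootdata V V')
    (hB : crystallographic B) :
  exists F : {Psi : set V & set (root_lattice B Psi -> int)} ->
             (root_system B -> set int),
    set_bij (@subsystem_cosets R V V' B) [set Z | root_function Z] F /\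
    forall p, subsystem_cosets p -> unique (attached p) (F p).
Proof.
exists (@attached_function R V V' B); split; last first.
  move=> p hp; split=> [|Z]; first exact: attached_attached_function.
  by apply: attached_inj; exact: attached_attached_function.
split=> [p hp|p q /set_mem hp /set_mem hq epq|Z /= rZ].
- by have [] := attached_attached_function hB hp.
- apply: (attached_cancel hB hp hq (attached_attached_function hB hp)).
  by rewrite epq; exact: attached_attached_function.
- have [p hp pZ] := ex_attached hB rZ; exists p => //.
  exact: attached_inj (attached_attached_function hB hp) pZ.
Qed.
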